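(* For all $r\in\{2,\dots,n-2\}$ with $r>m_1$, the Macaulayfication of $K[\mathcal P_r]$ is $K[\mathcal S]$.
   Context: $K$ is an infinite field, $n\ge4$, and $m_1<\dots<m_n$ is an arithmetic sequence of relatively prime positive integers: $m_i=m_1+(i-1)d$ with $m_1,d\in\mathbb Z^+$ and $\gcd\{m_1,d\}=1$. Let $a_i=(m_i,m_n-m_i)\in\mathbb N^2$ for $1\le i\le n-1$, $a_n=(m_n,0)$, $a_{n+1}=(0,m_n)$. $\mathcal S\subset\mathbb N^2$ is the semigroup (with $0$) generated by $\{a_1,\dots,a_{n+1}\}$ and $\mathcal P_r$ the one generated by $\{a_1,\dots,a_{n+1}\}\setminus\{a_r\}$. For a semigroup $\mathcal T$, $K[\mathcal T]=K[t^s\mid s\in\mathcal T]$. For semigroups $\mathcal T,\mathcal T'\subset\mathbb N^2$ with $K[\mathcal T]$ a simplicial semigroup ring of Krull dimension $2$, $K[\mathcal T']$ is the Macaulayfication of $K[\mathcal T]$ if: (1) $\mathcal T\subset\mathcal T'$; (2) $K[\mathcal T']$ is Cohen–Macaulay; (3) the Krull dimension of $K[\mathcal T'\setminus\mathcal T]$ is at most $0$ (Krull dimension of $K[\mathcal T]$ minus $2$), where $K[\mathcal T'\setminus\mathcal T]$ denotes the $K[\mathcal T]$-module $K[\mathcal T']/K[\mathcal T]$. *)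

(* Defs.v *)
From HB Require Import structures.
From mathcomp Require Import all_boot all_order all_algebra.
From mathcomp Require Import boolp.
From mathcomp Require Import mpoly.

Set Implicit Arguments.
Unset Strict Implicit.
Unset Printing Implicit Defensive.

Import GRing.Theory.
Local Open Scope ring_scope.

Section CommutativeAlgebra.
Variable R : comNzRingType.
Implicit Types (I Q m : {pred R}) (s : seq R).

(** [idealr_closed] describes a proper ideal: it includes [1 \notin Q]. *)
Definition prime_ideal Q : Prop :=
  idealr_closed Q /\ prime_idealr_closed Q.

Definition maximal_ideal m : Prop :=
  idealr_closed m /\
  forall I, idealr_closed I -> {subset m <= I} -> {subset I <= m}.

Definition in_ideal_span s (x : R) : Prop :=
  exists c : 'I_(size s) -> R, x = \sum_(i < size s) c i * s`_i.

(** Restricting to proper ideals loses nothing: the unit ideal is [(1)]. *)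
Definition noetherian : Prop :=
  forall I, idealr_closed I -> exists s, forall x, x \in I <-> in_ideal_span s x.

Definition regular_sequence s : Prop :=
  ~ in_ideal_span s 1 /\
  forall i, (i < size s)%N -> forall x,
    in_ideal_span (take i s) (s`_i * x) -> in_ideal_span (take i s) x.

(** Only the values [P 0], ..., [P l] matter. *)
Definition prime_chain (l : nat) (P : nat -> {pred R}) : Prop :=
  (forall i, (i <= l)%N -> prime_ideal (P i)) /\
  (forall i, (i < l)%N ->
     {subset P i <= P i.+1} /\ ~ {subset P i.+1 <= P i}).

Definition height_eq Q (h : nat) : Prop :=
  (exists P, prime_chain h P /\ P h =i Q) /\
  (forall l P, prime_chain l P -> P l =i Q -> (l <= h)%N).

Definition depth_eq I (k : nat) : Prop :=
  (exists s, [/\ regular_sequence s, {subset s <= I} & size s = k]) /\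
  (forall s, regular_sequence s -> {subset s <= I} -> (size s <= k)%N).

(** Eisenbud's definition for rings that need not be local: the depth and the
    height of a maximal ideal [m] are the depth and the dimension of the local
    ring at [m]. *)
Definition cohen_macaulay : Prop :=
  noetherian /\
  forall m, maximal_ideal m -> exists h, height_eq m h /\ depth_eq m h.

(** Krull dimension of [R / (A)]. If [M] is a finitely generated [R]-module
    and [A] its annihilator, this is the Krull dimension of [M].  When
    [M = 0] no prime contains [A], and [krull_dim_le A d] holds for all [d]. *)
Definition krull_dim_le (A : R -> Prop) (d : nat) : Prop :=
  forall l P, prime_chain l P -> (forall x, A x -> x \in P 0%N) -> (l <= d)%N.

Definition krull_dim_eq (A : R -> Prop) (d : nat) : Prop :=
  (exists P, prime_chain d P /\ forall x, A x -> x \in P 0%N) /\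
  krull_dim_le A d.

Definition ring_krull_dim_eq (d : nat) : Prop := krull_dim_eq (eq 0) d.

End CommutativeAlgebra.

(** A subsemigroup of [N^2] containing [0] is an [addrClosed N2]. *)
Notation N2 := (nat * nat)%type.

Section Generated.
Variable A : seq N2.

Definition generated_semigroup : {pred N2} :=
  fun x => `[< exists c : 'I_(size A) -> nat, x = \sum_(i < size A) A`_i *+ c i >].

Fact generated_semigroup_closed : GRing.nmod_closed generated_semigroup.
Proof.
split=> [|_ _ /asboolP[c ->] /asboolP[c' ->]]; apply/asboolP.
  by exists (fun=> 0%N); rewrite big1.
exists (fun i => (c i + c' i)%N); rewrite -big_split /=.
by apply: eq_bigr => i _; rewrite mulrnDr.
Qed.

HB.instance Definition _ :=
  GRing.isAddClosed.Build N2 generated_semigroup generated_semigroup_closed.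

End Generated.

(** The rational cone spanned by [T] is spanned by linearly independent
    elements of [T]: some positive multiple of each element of [T] lies in the
    semigroup that these generate. *)
Definition simplicial (T : {pred N2}) : Prop :=
  exists B : seq N2,
    [/\ {subset B <= T},
        row_free (\matrix_(i < size B, j < 2)
          (if j == 0 then (B`_i).1 else (B`_i).2)%:R : 'M[rat]_(_, _))
      & forall x, x \in T ->
          exists2 k : nat, (0 < k)%N & x *+ k \in generated_semigroup B].

Definition mexponent (m : 'X_{1..2}) : N2 := (m ord0, m ord_max).

(** [K[T]] as a subring of the polynomial ring [K[t_0, t_1]]. *)
Definition supported_in (K : fieldType) (T : {pred N2}) : {pred {mpoly K[2]}} :=
  fun p => all (fun m => mexponent m \in T) (msupp p).
Arguments supported_in : clear implicits.

Section SemigroupRing.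
Variables (K : fieldType) (T : addrClosed N2).

Fact supported_in_subring : GRing.subring_closed (supported_in K T).
Proof.
have supp1 : (1 : {mpoly K[2]}) \in supported_in K T.
  apply/allP => m; rewrite msupp1 inE => /eqP->.
  by rewrite /mexponent !mnm0E (rpred0 T).
split=> // p q /allP sp /allP sq; apply/allP => m.
  move=> /msuppB_le; rewrite mem_cat => /orP[/sp|/sq] //.
move=> /msuppM_le /allpairsP[[m1 m2] /= [/sp m1T /sq m2T ->]].
have -> : mexponent (m1 + m2)%MM = mexponent m1 + mexponent m2.
  by rewrite /mexponent !mnmDE.
exact: rpredD.
Qed.

HB.instance Definition _ :=
  GRing.isSubringClosed.Build {mpoly K[2]} (supported_in K T)
    supported_in_subring.

Record semigroup_ring : Type := SemigroupRing {
  sgval : {mpoly K[2]};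
  sgvalP : sgval \in supported_in K T }.

HB.instance Definition _ := [isSub for sgval].
HB.instance Definition _ := [Choice of semigroup_ring by <:].
HB.instance Definition _ :=
  [SubChoice_isSubComNzRing of semigroup_ring by <:].

End SemigroupRing.

(** The annihilator of the [K[T]]-module [K[T'] / K[T]], for [T] contained in
    [T']: multiplication by [f] sends all of [K[T']] into [K[T]]. *)
Definition quotient_annihilator (K : fieldType) (T T' : addrClosed N2)
    (f : semigroup_ring K T) : Prop :=
  forall g : semigroup_ring K T', sgval f * sgval g \in supported_in K T.

(** The first two fields are the standing assumptions on [K[T]] under which
    the notion is defined; the bound [0] in the last one is [dim K[T] - 2]. *)
Record is_macaulayfication (K : fieldType) (T T' : addrClosed N2) : Prop := {
  mac_simplicial : simplicial T;
  mac_dim2 : ring_krull_dim_eq (semigroup_ring K T) 2;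
  mac_subset : {subset T <= T'};
  mac_cohen_macaulay : cohen_macaulay (semigroup_ring K T');
  mac_quotient_dim : krull_dim_le (@quotient_annihilator K T T') 0
}.

Section ArithmeticSequence.
Variables (n m1 d : nat).

Definition arith_term (i : nat) : nat := (m1 + i.-1 * d)%N.

(** [a_i] for [1 <= i <= n + 1]; the second branch also gives
    [a_n = (m_n, 0)]. *)
Definition curve_point (i : nat) : N2 :=
  if i == n.+1 then (0%N, arith_term n)
  else (arith_term i, (arith_term n - arith_term i)%N).

Definition curve_generators : seq N2 := [seq curve_point i | i <- iota 1 n.+1].

Definition curve_semigroup : addrClosed N2 :=
  generated_semigroup curve_generators.

Definition punctured_curve_semigroup (r : nat) : addrClosed N2 :=
  generated_semigroup [seq a <- curve_generators | a != curve_point r].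

End ArithmeticSequence.

(* Main.v *)
Require Import Defs.
From HB Require Import structures.
From mathcomp Require Import all_boot all_order all_algebra.
From mathcomp Require Import boolp.
From mathcomp Require Import mpoly.
From mathcomp Require classical_sets.
From mathcomp Require Import zify ring.

(** Write [D] for [m_n], [u = t^(D, 0)] and [v = t^(0, D)].

    A pair [(x, y)] lies in [S] iff [x + y = k D] and [x = j m_1 + i d] with
    [j <= k] and [i <= j (n - 1)]; it follows that [s + (D, 0)] and [s + (0, D)]
    both lie in [S] only if [s] does.  Hence, for nonzero univariate [p] and
    [q], the sequence [p(u), q(v)] is regular on [K[S]] as soon as it generates
    a proper ideal: the quotient computed in [K[x, y]] has its support in [S].
    Every maximal ideal [m] contains such a pair.  Indeed [m] contains a
    nonzero [G(u, v)], and if [m] met [K[u]] trivially, the field [K[S]/m]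
    would be finite over a localization [K[u][1/c]].  So the depth of [m] is at
    least [2]; a prime over [p(u)] that avoids the products [w q(v)], with [w]
    outside [m] and [q] nonzero, shows the same for its height.

    Neither can exceed [2]: three successive nonzerodivisors modulo an
    increasing chain of ideals are algebraically independent over [K], while
    three elements of [K[x, y]] are always dependent.

    Finally [a_r + a_r = a_(r-1) + a_(r+1)], [a_r + a_n = a_(r+1) + a_(n-1)]
    and, because [r > m_1], [a_r + d a_(n+1) = d a_1 + a_(r - m_1)].  So [u^d]
    and [v^d] annihilate [K[S]/K[P_r]], and only the irrelevant maximal ideal of
    [K[P_r]] contains both. *)

Set Implicit Arguments.
Unset Strict Implicit.
Unset Printing Implicit Defensive.

Import GRing.Theory.
Local Open Scope ring_scope.

(** * Ideals, evaluation and the Hilbert basis theorem *)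

Section Ideals.
Variable R : comNzRingType.
Implicit Types (I : R -> Prop) (x y : R) (s : seq R).

(* Unlike [idealr_closed], this allows the unit ideal. *)
Definition ideal_prop I := I 0 /\ forall a x y, I x -> I y -> I (a * x + y).

Section IdealTheory.
Variable I : R -> Prop.
Hypothesis idI : ideal_prop I.

Lemma ideal_zero : I 0. Proof. by case: idI. Qed.

Lemma ideal_mull a x : I x -> I (a * x).
Proof. by move=> Ix; rewrite -[_ * _]addr0; apply: idI.2 => //; apply: ideal_zero. Qed.

Lemma ideal_mulr a x : I x -> I (x * a).
Proof. by rewrite mulrC; apply: ideal_mull. Qed.

Lemma ideal_add x y : I x -> I y -> I (x + y).
Proof. by move=> Ix Iy; rewrite -[x]mul1r; apply: idI.2. Qed.

Lemma ideal_opp x : I x -> I (- x).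
Proof. by move=> Ix; rewrite -mulN1r; apply: ideal_mull. Qed.

Lemma ideal_sub x y : I x -> I y -> I (x - y).
Proof. by move=> Ix Iy; apply: ideal_add => //; apply: ideal_opp. Qed.

Lemma ideal_sum (J : Type) (r : seq J) (P : pred J) (F : J -> R) :
  (forall j, P j -> I (F j)) -> I (\sum_(j <- r | P j) F j).
Proof. by move=> IF; apply: big_ind => //; [apply: ideal_zero | apply: ideal_add]. Qed.

Lemma ideal_span_sub s x :
  (forall y, y \in s -> I y) -> in_ideal_span s x -> I x.
Proof.
move=> Is [c ->]; apply: ideal_sum => i _.
by apply: ideal_mull; apply: Is; rewrite mem_nth.
Qed.

End IdealTheory.

Lemma ideal_span_ideal s : ideal_prop (in_ideal_span s).
Proof.
split=> [|a _ _ [c ->] [c' ->]].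
  by exists (fun=> 0); rewrite big1 // => i _; rewrite mul0r.
exists (fun i => a * c i + c' i); rewrite mulr_sumr -big_split /=.
by apply: eq_bigr => i _; rewrite mulrDl mulrA.
Qed.

Lemma mem_ideal_span s x : x \in s -> in_ideal_span s x.
Proof.
move=> xs; have xi : (index x s < size s)%N by rewrite index_mem.
exists (fun i => (i == Ordinal xi)%:R).
rewrite (bigD1 (Ordinal xi)) //= eqxx mul1r nth_index // big1 ?addr0 //.
by move=> i /negbTE ->; rewrite mul0r.
Qed.

Lemma idealr_closed_ideal (Q : {pred R}) :
  idealr_closed Q -> ideal_prop (fun x => x \in Q).
Proof. by case=> Q0 _ QD; split=> // a x y Qx Qy; apply: QD. Qed.

(** The unit ideal, which [idealr_closed] excludes, is spanned by [1]. *)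
Lemma noetherianP :
  noetherian R <->
  forall I, ideal_prop I -> exists s, forall x, I x <-> in_ideal_span s x.
Proof.
split=> [noeR I idI|noeR I /idealr_closed_ideal idI]; last exact: noeR.
have [I1|nI1] := pselect (I 1).
  exists [:: 1] => x; split=> _; last by rewrite -[x]mulr1; apply: ideal_mull.
  rewrite -[x]mulr1; apply: (ideal_mull (ideal_span_ideal _)).
  by apply: mem_ideal_span; rewrite inE.
have [|s sP] := noeR (fun x => `[< I x >]).
  split; first by apply/asboolP; apply: ideal_zero.
    by apply/negP => /asboolP.
  by move=> a x y /asboolP Ix /asboolP Iy; apply/asboolP/idI.2.
by exists s => x; rewrite -sP; split=> [Ix|/asboolP //]; apply/asboolP.
Qed.

End Ideals.

Section Evaluation.
Variables (B R : comNzRingType) (phi : {rmorphism B -> R}) (x : R).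

(** Nested uses evaluate polynomials in several variables: the outermost variable goes to the [x] of
    the outermost [eval_at]. *)
Definition eval_at : {poly B} -> R := horner_morph (fun b => mulrC x (phi b)).

HB.instance Definition _ := GRing.RMorphism.copy eval_at eval_at.

Lemma eval_atC c : eval_at c%:P = phi c. Proof. exact: horner_morphC. Qed.
Lemma eval_atX : eval_at 'X = x. Proof. exact: horner_morphX. Qed.

Lemma eval_at_MXaddC p c : eval_at (p * 'X + c%:P) = eval_at p * x + phi c.
Proof. by rewrite rmorphD rmorphM /= eval_atX eval_atC. Qed.

Lemma eval_atE (p : {poly B}) k :
  (size p <= k)%N -> eval_at p = \sum_(i < k) phi p`_i * x ^+ i.
Proof.
move=> pk; rewrite /eval_at /horner_morph.
rewrite (@horner_coef_wide _ k) ?(leq_trans (size_poly _ _)) //.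
by apply: eq_bigr => i _; rewrite coef_map.
Qed.

(* If [x] is a nonzerodivisor modulo [I], then factoring powers of [x] out of
   [p] leaves a polynomial whose constant term lies in [I']. *)
Lemma eval_at_inj_mod (I I' : R -> Prop) :
    ideal_prop I' -> (forall y, I y -> I' y) -> I' x ->
    (forall w, I (x * w) -> I w) -> (forall b, I' (phi b) -> b = 0) ->
  forall p, I (eval_at p) -> p = 0.
Proof.
move=> idI' II' I'x regx phi0; elim/poly_ind => // p c IH Ip.
have c0 : c = 0.
  apply: phi0; rewrite -eval_atC -[c%:P](addKr (p * 'X)) addrC.
  rewrite raddfD raddfN /=; apply: (ideal_sub idI'); first exact: II'.
  by rewrite rmorphM /= eval_atX; apply: ideal_mull.
move: Ip; rewrite c0 addr0 rmorphM /= eval_atX mulrC => /regx/IH ->.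
by rewrite mul0r.
Qed.

End Evaluation.

(** * Noetherian rings: images, fields, polynomial rings *)

Section Noetherian.

Lemma noetherian_image (B R : comNzRingType) (phi : {rmorphism B -> R}) :
  (forall y, exists b, phi b = y) -> noetherian B -> noetherian R.
Proof.
move=> surj /noetherianP noeB; apply/noetherianP => I idI.
have [|s sP] := noeB (fun b => I (phi b)).
  split=> [|a b c Ib Ic]; first by rewrite rmorph0; apply: ideal_zero.
  by rewrite rmorphD rmorphM; apply: idI.2.
exists [seq phi b | b <- s] => y; split; last first.
  apply: ideal_span_sub => // _ /mapP[b bs ->].
  by apply/sP/mem_ideal_span.
have [b <-] := surj y; move=> /sP[c ->].
rewrite rmorph_sum; apply: ideal_sum => [|i _]; first exact: ideal_span_ideal.
rewrite rmorphM; apply: ideal_mull; first exact: ideal_span_ideal.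
by apply/mem_ideal_span/map_f/mem_nth.
Qed.

Lemma noetherian_field (K : fieldType) : noetherian K.
Proof.
apply/noetherianP => I idI.
have [[x [Ix x0]]|nI] := pselect (exists x, I x /\ x != 0).
  exists [:: 1] => y; split=> _.
    rewrite -[y]mulr1; apply: (ideal_mull (ideal_span_ideal _)).
    by apply: mem_ideal_span; rewrite inE.
  by rewrite -[y](mulfVK x0); apply: ideal_mull.
exists [::] => y; split=> [Iy|[c ->]]; last by rewrite big_ord0; apply: ideal_zero.
exists (fun=> 0); rewrite big_ord0; apply/eqP/negPn/negP => y0.
by apply: nI; exists y.
Qed.

Variable B : comNzRingType.
Hypothesis noeB : noetherian B.

Section LeadingCoefficients.
Variable I : {poly B} -> Prop.
Hypothesis idI : ideal_prop I.

(** Only a size bound is imposed on [f], so [b] may be [0] and each [lead i] is an ideal. *)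
Let lead i (b : B) := exists f, [/\ I f, (size f <= i.+1)%N & f`_i = b].

Let lead_ideal i : ideal_prop (lead i).
Proof.
split=> [|a _ _ [f [If sf <-]] [g [Ig sg <-]]].
  by exists 0; rewrite size_poly0 coef0; split=> //; apply: ideal_zero.
exists (a%:P * f + g); split; first exact: idI.2.
  rewrite (leq_trans (size_polyD _ _)) // geq_max sg andbT mul_polyC.
  exact: leq_trans (size_scale_leq _ _) sf.
by rewrite coefD coefCM.
Qed.

Let lead_mono i j b : (i <= j)%N -> lead i b -> lead j b.
Proof.
move=> /subnK <- [f [If sf <-]]; exists ('X^(j - i) * f).
split; first exact: ideal_mull.
  by rewrite (leq_trans (size_polyMleq _ _)) // size_polyXn; lia.
by rewrite coefXnM ltnNge leq_addr addKn.
Qed.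

Let spans_lead i (G : seq {poly B}) := forall c, lead i c ->
  exists f, [/\ in_ideal_span G f, (size f <= i.+1)%N & f`_i = c].

Let lead_finite i :
  exists G, (forall g, g \in G -> I g) /\ spans_lead i G.
Proof.
have [s sP] := (noetherianP B).1 noeB _ (lead_ideal i).
have /choice[F FP] : forall b, exists f,
    lead i b -> [/\ I f, (size f <= i.+1)%N & f`_i = b].
  move=> b; have [[f fP]|nl] := pselect (lead i b).
    by exists f.
  by exists 0.
have ls b : b \in s -> lead i b by move=> bs; apply/sP/mem_ideal_span.
exists [seq F b | b <- s]; split.
  by move=> _ /mapP[b /ls/FP[? _ _] ->].
move=> c /sP[a ->]; exists (\sum_(j < size s) (a j)%:P * F s`_j); split.
- apply: ideal_sum => [|j _]; first exact: ideal_span_ideal.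
  apply: ideal_mull; first exact: ideal_span_ideal.
  by apply/mem_ideal_span/map_f/mem_nth.
- apply: (leq_trans (size_sum _ _ _)); apply/bigmax_leqP => j _.
  rewrite mul_polyC (leq_trans (size_scale_leq _ _)) //.
  by have [_] := FP _ (ls _ (mem_nth 0 (ltn_ord j))).
rewrite coef_sum; apply: eq_bigr => j _; rewrite coefCM.
by have [_ _ ->] := FP _ (ls _ (mem_nth 0 (ltn_ord j))).
Qed.

Let spans_leadS i G G' :
  {subset G <= G'} -> spans_lead i G -> spans_lead i G'.
Proof.
move=> GG' sG c /sG[f [fG sf fi]]; exists f; split=> //.
apply: ideal_span_sub fG; first exact: ideal_span_ideal.
by move=> y /GG'; apply: mem_ideal_span.
Qed.

Let lead_finite_upto N : exists G, (forall g, g \in G -> I g) /\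
  forall i, (i < N)%N -> spans_lead i G.
Proof.
elim: N => [|N [G [GI GN]]]; first by exists [::]; split.
have [G' [GI' GN']] := lead_finite N.
exists (G ++ G'); split=> [g|i].
  by rewrite mem_cat => /orP[/GI|/GI'].
rewrite ltnS leq_eqVlt => /orP[/eqP ->|/GN].
  by apply: spans_leadS GN' => g gG; rewrite mem_cat gG orbT.
by apply: spans_leadS => g gG; rewrite mem_cat gG.
Qed.

(** The [lead i] increase, so their union is an ideal, and its finitely many generators all occur at
    one stage. *)
Let lead_stationary : exists N, forall i c, lead i c -> lead N c.
Proof.
have [|s sP] := (noetherianP B).1 noeB (fun b => exists i, lead i b).
  split=> [|a x y [i li] [j lj]]; first by exists 0%N; apply: ideal_zero.
  exists (maxn i j); apply: (lead_ideal _).2.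
    by apply: lead_mono li; apply: leq_maxl.
  by apply: lead_mono lj; apply: leq_maxr.
have [N sN] : exists N, forall b, b \in s -> lead N b.
  have ls b : b \in s -> exists i, lead i b.
    by move=> bs; apply/sP/mem_ideal_span.
  elim: s {sP} ls => [|b s IH] ls; first by exists 0%N.
  have [|N sN] := IH; first by move=> c cs; apply: ls; rewrite inE cs orbT.
  have [i li] := ls b (mem_head _ _).
  exists (maxn i N) => c; rewrite inE => /orP[/eqP ->|/sN].
    by apply: lead_mono li; apply: leq_maxl.
  by apply: lead_mono; apply: leq_maxr.
exists N => i c lc; apply: (ideal_span_sub (lead_ideal N) sN).
by apply/sP; exists i.
Qed.

(** [G] lifts generators of [lead i] for [i <= N]; higher degrees are reached through powers of
    ['X], and an induction on size cancels the leading coefficient of [f]. *)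
Lemma ideal_poly_finite : exists G, forall f, I f <-> in_ideal_span G f.
Proof.
have [N statN] := lead_stationary.
have [G [GI GN]] := lead_finite_upto N.+1.
have Glead i : spans_lead i G.
  have [iN|iN] := ltnP i N.+1; first exact: GN.
  move=> c /statN /(GN _ (ltnSn N)) [f [Gf sf fi]].
  exists ('X^(i - N) * f); split.
  - by apply: ideal_mull => //; apply: ideal_span_ideal.
  - by rewrite (leq_trans (size_polyMleq _ _)) // size_polyXn; lia.
  by rewrite coefXnM ltnNge leq_subr /= subKn // ltnW.
exists G => f; split; last exact: ideal_span_sub.
move: {2}(size f) (leqnn (size f)) => k; elim: k f => [|k IH] f.
  by rewrite size_poly_leq0 => /eqP -> _; apply: ideal_zero; apply: ideal_span_ideal.
move=> sf If; have [|g [Gg sg gk]] := Glead k f`_k; first by exists f.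
rewrite -(subrK g f); apply: (ideal_add (ideal_span_ideal _)) => //.
apply: IH; last by apply: ideal_sub => //; apply: ideal_span_sub Gg.
apply/leq_sizeP => j; rewrite leq_eqVlt => /orP[/eqP <-|kj].
  by rewrite coefB gk subrr.
rewrite coefB [f`_j]nth_default ?[g`_j]nth_default ?subrr //.
  exact: leq_trans sg kj.
exact: leq_trans sf kj.
Qed.

End LeadingCoefficients.

Lemma hilbert_basis : noetherian {poly B}.
Proof. by apply/noetherianP => I idI; apply: ideal_poly_finite. Qed.

End Noetherian.

(** The hypothesis is the induction principle of a [K]-algebra generated by [gs]; such an [R] is an
    image of an iterated polynomial ring over [K]. *)
Lemma noetherian_finitely_generated (K : fieldType) (R : comNzRingType)
    (iota : {rmorphism K -> R}) (gs : seq R) :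
    (forall P : R -> Prop, (forall c, P (iota c)) ->
      (forall g, g \in gs -> P g) -> (forall x y, P x -> P y -> P (x + y)) ->
      (forall x y, P x -> P y -> P (x * y)) -> forall x, P x) ->
  noetherian R.
Proof.
move=> gen.
have [B [phi [noeB phiK phig]]] : exists (B : comNzRingType)
    (phi : {rmorphism B -> R}), [/\ noetherian B,
      (forall c, exists b, phi b = iota c)
    & (forall g, g \in gs -> exists b, phi b = g)].
  elim: gs {gen} => [|g gs [B [phi [noeB phiK phig]]]].
    exists K, iota; split=> [|c|//]; first exact: noetherian_field.
    by exists c.
  exists {poly B}, (eval_at phi g); split.
  - exact: hilbert_basis.
  - by move=> c; have [b <-] := phiK c; exists b%:P; rewrite /= eval_atC.
  move=> h; rewrite inE => /orP[/eqP ->|/phig[b <-]].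
    by exists 'X; rewrite /= eval_atX.
  by exists b%:P; rewrite /= eval_atC.
apply: (noetherian_image (phi := phi)) => //; apply: gen => //.
  by move=> _ _ [b <-] [c <-]; exists (b + c); rewrite rmorphD.
by move=> _ _ [b <-] [c <-]; exists (b * c); rewrite rmorphM.
Qed.

(** * Maximal ideals of finite algebras over [K[u, v]] *)

Section Determinants.
Variables (R : comNzRingType) (q : R).

(** A determinant is a polynomial in its entries, so congruence modulo [q] passes to it. *)
Lemma det_congr n (A B : 'M[R]_n) :
    (forall i j, exists t, A i j = B i j + q * t) ->
  exists t, \det A = \det B + q * t.
Proof.
move=> AB; rewrite /determinant.
pose E (x y : R) := exists t, x = y + q * t.
have E_refl x : E x x by exists 0; rewrite mulr0 addr0.
have E_add x y x' y' : E x x' -> E y y' -> E (x + y) (x' + y').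
  by move=> [s ->] [t ->]; exists (s + t); ring.
have E_mul x y x' y' : E x x' -> E y y' -> E (x * y) (x' * y').
  by move=> [s ->] [t ->]; exists (x' * t + s * y' + q * s * t); ring.
apply: (big_ind2 E) => [|x x' y y'|s _]; [exact: E_refl | exact: E_add |].
apply: (E_mul _ _ _ _ (E_refl _)).
by apply: (big_ind2 E) => [|x x' y y'|i _]; [exact: E_refl | exact: E_mul |].
Qed.

Lemma det_scalarB n (s : R) (M : 'M[R]_n) :
  exists t, \det (s%:M - q *: M) = s ^+ n + q * t.
Proof.
rewrite -(det_scalar n s); apply: det_congr => i j.
by exists (- M i j); rewrite !mxE mulrN.
Qed.

End Determinants.

Section MaximalContraction.
Variables (K : fieldType) (R : comNzRingType) (iota : {rmorphism K -> R}).
Variables (u v : R) (J : finType) (e : J -> R) (m : R -> Prop).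

Local Notation phi := (eval_at iota u).
Local Notation psi := (eval_at phi v).

Hypothesis idm : ideal_prop m.
Hypothesis m_max : forall x, m x \/ exists z, m (z * x - 1).
Hypothesis gen :
  forall x, exists p : J -> {poly {poly K}}, x = \sum_j psi (p j) * e j.

(* If [m] met [K[u]] trivially, then with [c] the leading coefficient of [G] in
   [v], the field [R/m] would be a finite [K[u][1/c]]-module containing the
   inverse of [q = 1 + u c]; by the determinant trick [q] would divide a power
   of [c]. *)
Lemma maximal_contraction (G : {poly {poly K}}) :
  G != 0 -> m (psi G) -> exists p, p != 0 /\ m (phi p).
Proof.
move=> G0 mG; apply: contrapT => np.
have m0 p : m (phi p) -> p = 0.
  by move=> mp; apply/eqP/negPn/negP => p0; apply: np; exists p.
pose c := lead_coef G; have c0 : c != 0 by rewrite lead_coef_eq0.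
pose k := size G; pose q : {poly K} := 1 + 'X * c.
(* Pseudo-division by [G]. Every exponent from [N] on is allowed, so that finitely many [p] can
   share one. *)
have divG p : exists N, forall N', (N <= N')%N -> exists r : {poly {poly K}},
    (size r <= k)%N /\ m (phi (c ^+ N') * psi p - psi r).
  exists (scalp p G) => N' NN'.
  exists (c ^+ (N' - scalp p G) *: (p %% G)); split.
    rewrite (leq_trans (size_scale_leq _ _)) // ltnW //.
    by rewrite ltn_modp.
  have -> : phi (c ^+ N') = psi (c ^+ N')%:P by rewrite eval_atC.
  rewrite -rmorphM -rmorphB.
  have -> : (c ^+ N')%:P * p - c ^+ (N' - scalp p G) *: (p %% G)
      = (c ^+ (N' - scalp p G))%:P * (p %/ G) * G.
    rewrite -(subnK NN') exprD addnK polyCM -!mulrA -mul_polyC -mulrBr.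
    rewrite (mul_polyC (c ^+ scalp p G)) Pdiv.Idomain.divp_eq.
    by rewrite addrK.
  by rewrite rmorphM; apply: ideal_mull.
(* Once [c] is inverted, the products [v ^+ i * e j] with [i < k] span [R/m] over [K[u]]. *)
pose T : finType := (J * 'I_k)%type; pose b (t : T) := v ^+ t.2 * e t.1.
have span x : exists N, forall N', (N <= N')%N -> exists a : T -> {poly K},
    m (phi (c ^+ N') * x - \sum_t phi (a t) * b t).
  have [p ->] := gen x.
  have /choice[N NP] := fun j => divG (p j).
  exists (\max_j N j)%N => N' NN'.
  have /choice[r rP] j := NP j N' (leq_trans (leq_bigmax j) NN').
  exists (fun t : T => (r t.1)`_t.2).
  have -> : \sum_(t : T) phi (r t.1)`_t.2 * b t = \sum_j psi (r j) * e j.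
    rewrite -(pair_bigA _ (fun j (i : 'I_k) => phi (r j)`_i * (v ^+ i * e j))) /=.
    apply: eq_bigr => j _; rewrite (eval_atE _ _ (rP j).1) mulr_suml.
    by apply: eq_bigr => i _; rewrite mulrA.
  rewrite mulr_sumr -sumrB; apply: ideal_sum => // j _.
  by rewrite mulrA -mulrBl; apply: (ideal_mulr idm); apply: (rP j).2.
(* [q] has constant term [1], hence is nonzero and so invertible modulo [m]. *)
have [z mz] : exists z, m (z * phi q - 1).
  case: (m_max (phi q)) => // /m0 /eqP.
  have /negbTE -> // : q != 0.
  apply/eqP => /(congr1 (fun p : {poly K} => p`_0)).
  rewrite /q coefD coef1 coefXM coef0 addr0.
  by apply/eqP/oner_neq0.
have /choice[N NP] := fun t => span (z * b t).
pose N0 := (\max_t N t)%N.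
have /choice[M MP] t := NP t N0 (leq_bigmax t).
pose n := #|{: T}|.
(* Row [t] of [M] expands [c ^+ N0 * (z * b t)] in the [b s]. Multiplying by [q], with [z * q]
   congruent to [1], shows that [A] kills the vector [b] modulo [m]. *)
pose A : 'M[{poly K}]_n := (c ^+ N0)%:M
  - q *: (\matrix_(i, j) M (enum_val i) (enum_val j)).
have mA i : m (\sum_j phi (A i j) * b (enum_val j)).
  set t := enum_val i.
  have -> : \sum_j phi (A i j) * b (enum_val j) =
      phi (c ^+ N0) * b t - phi q * \sum_s phi (M t s) * b s.
    rewrite [in RHS](reindex (@enum_val T predT)) /=; last first.
      by apply: onW_bij; apply: enum_val_bij.
    under eq_bigr => j _ do rewrite !mxE rmorphB rmorphM mulrBl -mulrA.
    rewrite sumrB -mulr_sumr; congr (_ - _).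
    rewrite (bigD1 i) //= eqxx mulr1n big1 ?addr0 // => j /negbTE ji.
    by rewrite eq_sym ji mulr0n rmorph0 mul0r.
  have -> : phi (c ^+ N0) * b t - phi q * \sum_s phi (M t s) * b s =
    phi q * (phi (c ^+ N0) * (z * b t) - \sum_s phi (M t s) * b s)
    - phi (c ^+ N0) * b t * (z * phi q - 1) by ring.
  by apply: ideal_sub => //; apply: ideal_mull.
(* By the adjugate matrix, multiplication by [\det A] sends every [b t] into [m]. *)
have mdet t : m (phi (\det A) * b t).
  rewrite -(enum_rankK t); set i := enum_rank t.
  have -> : phi (\det A) * b (enum_val i) =
      \sum_j phi ((\adj A *m A) i j) * b (enum_val j).
    rewrite mul_adj_mx (bigD1 i) //= mxE eqxx mulr1n big1 ?addr0 // => j /negbTE ji.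
    by rewrite mxE eq_sym ji mulr0n rmorph0 mul0r.
  have -> : \sum_j phi ((\adj A *m A) i j) * b (enum_val j) =
      \sum_l phi (\adj A i l) * \sum_j phi (A l j) * b (enum_val j).
    under eq_bigr => j _ do rewrite mxE rmorph_sum mulr_suml.
    rewrite exchange_big; apply: eq_bigr => l _; rewrite mulr_sumr.
    by apply: eq_bigr => j _; rewrite rmorphM mulrA.
  by apply: ideal_sum => // l _; apply: ideal_mull.
(* A power of [c] lies in the span of the [b t] modulo [m], so [\det A * c ^+ N1] is in the
   contraction of [m] to [K[u]], assumed trivial. *)
have [N1 /(_ _ (leqnn _)) [a ma]] := span 1.
have det0 : \det A = 0.
  apply/eqP; have /m0/eqP : m (phi (\det A * c ^+ N1)).
    rewrite rmorphM; move: ma; rewrite mulr1 => /(ideal_mull idm (phi (\det A))).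
    rewrite mulrBr => /(ideal_add idm); rewrite mulr_sumr.
    move=> /(_ (\sum_t phi (\det A) * (phi (a t) * b t))); rewrite subrK.
    by apply; apply: ideal_sum => // t _; rewrite mulrCA; apply: ideal_mull.
  by rewrite mulf_eq0 expf_eq0 (negbTE c0) andbF orbF.
have [t] : exists t, \det A = (c ^+ N0) ^+ n + q * t by apply: det_scalarB.
rewrite det0 -exprM => /eqP; rewrite eq_sym addr_eq0 => /eqP qc.
(* [q] divides a power of [c] yet is coprime to [c], so it would be constant, whereas its degree
   exceeds that of [c] by one. *)
have qdvd : q %| c ^+ (N0 * n) by rewrite qc -mulrN dvdp_mulr.
have cop : coprimep q (c ^+ (N0 * n)).
  apply: coprimep_expr; apply/coprimepP => w wq wc; rewrite -size_poly_eq1 -dvdp1.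
  have -> : 1 = q - 'X * c by rewrite /q addrK.
  by rewrite dvdp_sub // dvdp_mull.
have := coprimep_dvdl qdvd cop.
have sq : size q = (size c).+1.
  by rewrite /q addrC mulrC size_polyDl size_mulX // size_poly1 ltnS lt0n size_poly_eq0.
by rewrite coprimepp sq eqSS size_poly_eq0 (negbTE c0).
Qed.

End MaximalContraction.

(** * Prime ideals and algebraic dependence *)

Section PrimeAvoidance.
Variables (R : comNzRingType) (I U : R -> Prop).
Hypothesis idI : ideal_prop I.
Hypothesis U1 : U 1.
Hypothesis UM : forall x y, U x -> U y -> U (x * y).
Hypothesis IU : forall x, I x -> ~ U x.

(** Zorn's lemma gives an ideal maximal among those containing [I] and missing [U]; such an ideal is
    prime. *)
Lemma exists_prime_avoiding : exists Q : {pred R},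
  [/\ prime_ideal Q, forall x, I x -> x \in Q & forall x, x \in Q -> ~ U x].
Proof.
(* With [I] adjoined inside [ext], the empty set is a valid bound for the empty chain. *)
pose ext (X : R -> Prop) x := I x \/ X x.
pose P X := ideal_prop (ext X) /\ forall x, ext X x -> ~ U x.
have [|A [[idA AU] maxA]] := @classical_sets.Zorn_bigcup R P.
  move=> F FP totF; split; last first.
    by move=> x [/IU //|[X FX Xx]]; apply: (FP X FX).2; right.
  split=> [|a x y]; first by left; apply: ideal_zero.
  move=> [Ix|[X FX Xx]] [Iy|[Y FY Yy]].
  - by left; apply: idI.2.
  - have [?|?] := (FP Y FY).1.2 a x y (or_introl Ix) (or_intror Yy); first by left.
    by right; exists Y.
  - have [?|?] := (FP X FX).1.2 a x y (or_intror Xx) (or_introl Iy); first by left.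
    by right; exists X.
  have [XY|YX] := totF X Y FX FY.
    have [?|?] := (FP Y FY).1.2 a x y (or_intror (XY _ Xx)) (or_intror Yy); first by left.
    by right; exists Y.
  have [?|?] := (FP X FX).1.2 a x y (or_intror Xx) (or_intror (YX _ Yy)); first by left.
  by right; exists X.
(* Otherwise the ideal generated by [x] and [ext A] would be a larger candidate. *)
have meetU x : ~ ext A x -> exists a q, ext A q /\ U (a * x + q).
  move=> nAx; apply: contrapT => nU.
  pose B y := exists a q, ext A q /\ y = a * x + q.
  have extB : ext B = B.
    apply/funext => y; apply/propext; split=> [[Iy|//]|By]; last by right.
    by exists 0, y; rewrite mul0r add0r; split=> //; left.
  apply: (maxA B); first split.
  - by move=> y Ay; exists 0, y; rewrite mul0r add0r; split=> //; right.
  - move=> BA; apply: nAx; right; apply: BA.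
    by exists 1, 0; rewrite mul1r addr0; split=> //; apply: ideal_zero.
  rewrite /P extB; split.
    split=> [|b _ _ [a [q [Aq ->]]] [a' [q' [Aq' ->]]]].
      by exists 0, 0; rewrite mul0r addr0; split=> //; apply: ideal_zero.
    exists (b * a + a'), (b * q + q'); split; first exact: idA.2.
    by ring.
  by move=> y [a [q [Aq ->]]] Uy; apply: nU; exists a, q.
exists (fun x => `[< ext A x >]); split.
- split; [split|].
  + by apply/asboolP; apply: ideal_zero.
  + by apply/negP => /asboolP /AU.
  + by move=> a x y /asboolP Ax /asboolP Ay; apply/asboolP/idA.2.
  move=> x y /asboolP Axy; apply/orP.
  have [Ax|/meetU[a [p [Ap Ua]]]] := pselect (ext A x); first by left; apply/asboolP.
  have [Ay|/meetU[b [q [Aq Ub]]]] := pselect (ext A y); first by right; apply/asboolP.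
  (* The product lies in [U], but each term of its expansion lies in [ext A]. *)
  case: (AU _ _ (UM Ua Ub)).
  have -> : (a * x + p) * (b * y + q) = a * b * (x * y) + (a * x + p) * q + b * y * p.
    by ring.
  by do 2?[apply: ideal_add => //]; apply: ideal_mull.
- by move=> x Ix; apply/asboolP; left.
by move=> x /asboolP; apply: AU.
Qed.

End PrimeAvoidance.

Lemma domain_prime_kernel (R : comNzRingType) (S : idomainType)
  (f : {rmorphism R -> S}) : prime_ideal (fun x => f x == 0).
Proof.
split; first split.
- by rewrite unfold_in rmorph0.
- by rewrite unfold_in rmorph1 oner_eq0.
- move=> a x y; rewrite !unfold_in => /eqP fx /eqP fy.
  by rewrite rmorphD rmorphM fx fy mulr0 addr0.
by move=> x y; rewrite !unfold_in rmorphM mulf_eq0.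
Qed.

(** If no multiple of [x] is [1] modulo [m], then [m + (x)] is proper, and maximality puts [x] in
    [m]. *)
Lemma maximal_ideal_inverse (R : comNzRingType) (m : {pred R}) x :
  maximal_ideal m -> x \in m \/ exists z, z * x - 1 \in m.
Proof.
move=> [mI maxm]; have idm := idealr_closed_ideal mI.
have [xm|/negP xm] := boolP (x \in m); first by left.
right; apply: contrapT => nz; apply: xm.
pose I : {pred R} := fun y => `[< exists a q, q \in m /\ y = a * x + q >].
apply: (maxm I).
- split.
  + by apply/asboolP; exists 0, 0; rewrite mul0r addr0; case: mI.
  + apply/negP => /asboolP[a [q [qm e1]]]; apply: nz; exists a.
    by rewrite e1 opprD addNKr; apply: (ideal_opp idm).
  move=> b _ _ /asboolP[a [q [qm ->]]] /asboolP[a' [q' [qm' ->]]].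
  apply/asboolP; exists (b * a + a'), (b * q + q'); split; last by ring.
  exact: idm.2.
- by move=> y ym; apply/asboolP; exists 0, y; rewrite mul0r add0r.
by apply/asboolP; exists 1, 0; rewrite mul1r addr0; case: mI.
Qed.

Lemma maximal_ideal_prime (R : comNzRingType) (m : {pred R}) :
  maximal_ideal m -> prime_ideal m.
Proof.
move=> mm; have idm := idealr_closed_ideal mm.1; split; first exact: mm.1.
move=> x y xy; apply/orP.
have [xm|[z zx]] := maximal_ideal_inverse x mm; [by left | right].
have -> : y = z * (x * y) - y * (z * x - 1) by ring.
by apply: (ideal_sub idm); apply: (ideal_mull idm).
Qed.

Lemma exists_nontrivial_zero (F : fieldType) (a b : nat) (M : 'M[F]_(a, b)) :
  (b < a)%N -> exists2 c : 'rV_a, c != 0 & c *m M = 0.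
Proof.
move=> ba; have : kermx M != 0.
  rewrite -mxrank_eq0 mxrank_ker subn_eq0 -ltnNge.
  exact: leq_ltn_trans (rank_leq_col M) ba.
move=> /rowV0Pn[c cM c0]; exists c => //.
by apply/eqP; rewrite -sub_kermx.
Qed.

(** * Algebraic dependence of three polynomials in two variables *)

Section AlgebraicDependence.
Variable K : fieldType.

Definition degree_le (E : nat) (p : {mpoly K[2]}) :=
  forall m, p@_m != 0 -> (mdeg m <= E)%N.

Lemma degree_leM E E' p q :
  degree_le E p -> degree_le E' q -> degree_le (E + E')%N (p * q).
Proof.
move=> dp dq m; rewrite -mcoeff_msupp => /msuppM_le /allpairsP[[m1 m2]] /=.
rewrite !mcoeff_msupp => -[/dp m1E /dq m2E ->].
by rewrite mdegD leq_add.
Qed.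

Lemma degree_leX E p k : degree_le E p -> degree_le (k * E)%N (p ^+ k).
Proof.
move=> dp; elim: k => [|k IH]; last by rewrite exprS; apply: degree_leM.
move=> m; rewrite expr0 mcoeff1; case: (eqVneq m 0%MM) => [->|_].
  by rewrite mdeg0.
by rewrite eqxx.
Qed.

Lemma degree_le_exists p : exists E, degree_le E p.
Proof.
exists (\max_(m <- msupp p) mdeg m)%N => m; rewrite -mcoeff_msupp => mp.
exact: leq_bigmax_seq.
Qed.

(* The [N^3] monomials of degree less than [N] in each of [x], [y], [z] lie in
   the space of polynomials of degree at most [3NE], of dimension [O(N^2)]. *)
Lemma algebraic_dependence3 (x y z : {mpoly K[2]}) :
  exists N (c : nat -> nat -> nat -> K),
    (exists i j k : 'I_N, c i j k != 0) /\
    \sum_(i < N) \sum_(j < N) \sum_(k < N)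
      c i j k *: (x ^+ i * y ^+ j * z ^+ k) = 0.
Proof.
have [Ex dx] := degree_le_exists x; have [Ey dy] := degree_le_exists y.
have [Ez dz] := degree_le_exists z.
(* [Q <= N * E.+1] and [E.+1 ^ 2 < N] give [Q ^ 2 < N ^ 3]: there are more products [mon t] than
   exponent pairs. *)
pose E := (Ex + Ey + Ez)%N; pose N := (E.+1 ^ 2).+1; pose Q := (N * E).+1.
pose mon (t : 'I_N * 'I_N * 'I_N) := x ^+ t.1.1 * y ^+ t.1.2 * z ^+ t.2.
have dmon t : degree_le (N * E)%N (mon t).
  move=> m mm; 
  have dxy := degree_leM (degree_leX (k := t.1.1) dx) (degree_leX (k := t.1.2) dy).
  apply: leq_trans (degree_leM dxy (degree_leX (k := t.2) dz) _) _; first exact: mm.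
  rewrite /E !mulnDr.
  by do 2?[apply: leq_add]; apply: leq_mul => //; apply: ltnW.
pose mn (s : 'I_Q * 'I_Q) : 'X_{1..2} :=
  [multinom (if i == ord0 then s.1 : nat else s.2) | i < 2].
pose M : 'M[K]_(#|{: 'I_N * 'I_N * 'I_N}|, #|{: 'I_Q * 'I_Q}|) :=
  \matrix_(t, s) (mon (enum_val t))@_(mn (enum_val s)).
have [|c c0 cM] := exists_nontrivial_zero M.
  rewrite !card_prod !card_ord.
  have QN : (Q <= N * E.+1)%N by rewrite /Q mulnS /N; lia.
  apply: (@leq_ltn_trans ((N * E.+1) * (N * E.+1))%N); first exact: leq_mul.
  by rewrite mulnACA ltn_pmul2l // -mulnn ltnS.
pose c' (i j k : nat) := c ord0 (enum_rank (inord i : 'I_N, inord j : 'I_N, inord k : 'I_N)).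
exists N, c'; split.
  have /rV0Pn[t ct] := c0; exists (enum_val t).1.1, (enum_val t).1.2, (enum_val t).2.
  by rewrite /c' !inord_val -!surjective_pairing enum_valK.
have -> : \sum_(i < N) \sum_(j < N) \sum_(k < N)
      c' i j k *: (x ^+ i * y ^+ j * z ^+ k) =
    \sum_t c ord0 t *: mon (enum_val t).
  rewrite [in RHS](reindex (@enum_rank {: 'I_N * 'I_N * 'I_N})) /=; last first.
    by apply: onW_bij; apply: enum_rank_bij.
  rewrite [in RHS](eq_bigr (fun t =>
    c ord0 (enum_rank (t.1, t.2)) *: mon (t.1, t.2))); last first.
    by move=> t _; rewrite enum_rankK -surjective_pairing.
  rewrite -(pair_bigA _ (fun s k => c ord0 (enum_rank (s, k)) *: mon (s, k))) /=.
  rewrite pair_bigA /=; apply: eq_bigr => s _; apply: eq_bigr => k _.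
  by rewrite /c' !inord_val -surjective_pairing.
apply/mpolyP => m; rewrite mcoeff0 raddf_sum /=.
(* Monomials of degree above [N * E] occur in no [mon t]; the others index columns of [M]. *)
have [mQ|mQ] := leqP (mdeg m) (N * E); last first.
  apply: big1 => t _; rewrite mcoeffZ; apply/eqP; rewrite mulf_eq0.
  apply/orP; right; apply: contraTT mQ => /dmon; by rewrite -leqNgt.
have m01 : (m ord0 + m ord_max = mdeg m)%N.
  by rewrite mdegE !big_ord_recl big_ord0 addn0; congr (_ + m _)%N; apply: val_inj.
have lt0 : (m ord0 < Q)%N by rewrite ltnS (leq_trans _ mQ) // -m01 leq_addr.
have lt1 : (m ord_max < Q)%N by rewrite ltnS (leq_trans _ mQ) // -m01 leq_addl.
have := congr1 (fun A : 'rV[K]_#|{: 'I_Q * 'I_Q}| =>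
  A ord0 (enum_rank (Ordinal lt0, Ordinal lt1))) cM.
rewrite !mxE => e0; rewrite -[RHS]e0; apply: eq_bigr => t _; rewrite mcoeffZ mxE enum_rankK.
congr (_ * _@__); apply/mnmP => i; rewrite mnmE /=.
case: (unliftP ord0 i) => [j|] ->; last by rewrite eqxx.
by rewrite (ord1 j) /=; congr (m _); apply: val_inj.
Qed.

End AlgebraicDependence.

(** * Semigroup rings *)

Definition monomial_of (s : N2) : 'X_{1..2} :=
  [multinom (if i == ord0 then s.1 else s.2) | i < 2].

Lemma monomial_ofK s : mexponent (monomial_of s) = s.
Proof. by rewrite /mexponent !mnmE /= -surjective_pairing. Qed.

Lemma mexponentK m : monomial_of (mexponent m) = m.
Proof.
apply/mnmP => i; rewrite mnmE /=.
case: (unliftP ord0 i) => [j|] ->; last by rewrite eqxx.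
by rewrite (ord1 j) /=; congr (m _); apply: val_inj.
Qed.

Lemma monomial_ofD s t : monomial_of (s + t) = (monomial_of s + monomial_of t)%MM.
Proof. by apply/mnmP => i; rewrite mnmDE !mnmE; case: ifP. Qed.

Section SemigroupRingTheory.
Variables (K : fieldType) (T : addrClosed N2).
Local Notation R := (semigroup_ring K T).

Definition sgemb (f : R) : {mpoly K[2]} := val f.

Fact sgemb_zmod_morphism : zmod_morphism sgemb.
Proof. exact: (raddfB (val : R -> {mpoly K[2]})). Qed.

Fact sgemb_monoid_morphism : monoid_morphism sgemb.
Proof. by split=> [|f g]; [exact: rmorph1 | exact: rmorphM]. Qed.

HB.instance Definition _ :=
  GRing.isZmodMorphism.Build R {mpoly K[2]} sgemb sgemb_zmod_morphism.
HB.instance Definition _ :=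
  GRing.isMonoidMorphism.Build R {mpoly K[2]} sgemb sgemb_monoid_morphism.

(* Specialized because [sgval (f + g)] converts to [sgval f + sgval g]: a generic
   rewrite by [rmorphD] above [sgemb] would match that and unfold [sgemb]. *)
Lemma sgembD f g : sgemb (f + g) = sgemb f + sgemb g.
Proof. exact: rmorphD. Qed.

Lemma sgembM f g : sgemb (f * g) = sgemb f * sgemb g.
Proof. exact: rmorphM. Qed.

Lemma sgemb0 : sgemb 0 = 0. Proof. exact: rmorph0. Qed.

Lemma sgemb_inj : injective sgemb. Proof. exact: val_inj. Qed.

Lemma sgembP (f : R) m : (sgemb f)@_m != 0 -> mexponent m \in T.
Proof. by rewrite -mcoeff_msupp; apply: (allP (sgvalP f)). Qed.

Lemma supported_inP (p : {mpoly K[2]}) :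
  reflect (forall m, p@_m != 0 -> mexponent m \in T) (p \in supported_in K T).
Proof.
apply: (iffP allP) => sp m; first by rewrite -mcoeff_msupp; apply: sp.
by rewrite mcoeff_msupp; apply: sp.
Qed.

Lemma sgemb_surj p :
  (forall m, p@_m != 0 -> mexponent m \in T) -> exists f : R, sgemb f = p.
Proof. by move=> /supported_inP pT; exists (SemigroupRing pT). Qed.

Lemma sg_mulf_eq0 (x y : R) : x * y = 0 -> x != 0 -> y = 0.
Proof.
move=> /(congr1 sgemb); rewrite rmorphM rmorph0 => /eqP.
rewrite mulf_eq0 => /orP[] /eqP xy0 x0; last by apply: sgemb_inj; rewrite rmorph0.
by case/negP: x0; apply/eqP/sgemb_inj; rewrite rmorph0.
Qed.

Lemma sg_zero_prime : prime_ideal (fun x : R => x == 0).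
Proof.
split; first split.
- by rewrite unfold_in.
- by rewrite unfold_in oner_eq0.
- by move=> a x y; rewrite !unfold_in => /eqP -> /eqP ->; rewrite mulr0 addr0.
move=> x y; rewrite !unfold_in => /eqP xy; have [//|/= x0] := boolP (x == 0).
by rewrite (sg_mulf_eq0 xy x0).
Qed.

Definition sgconst (c : K) : R := insubd 0 c%:MP.

Lemma sgemb_const c : sgemb (sgconst c) = c%:MP.
Proof.
rewrite /sgemb /sgconst insubdK //; apply/supported_inP => m.
rewrite mcoeffC; case: (eqVneq m 0%MM) => [-> _|_]; last by rewrite mulr0 eqxx.
by rewrite /mexponent !mnm0E; apply: (rpred0 T).
Qed.

Fact sgconst_zmod_morphism : zmod_morphism sgconst.
Proof.
by move=> a b; apply: sgemb_inj; rewrite rmorphB /= !sgemb_const mpolyCB.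
Qed.

Fact sgconst_monoid_morphism : monoid_morphism sgconst.
Proof.
split; first by apply: sgemb_inj; rewrite rmorph1 sgemb_const.
by move=> a b; apply: sgemb_inj; rewrite rmorphM /= !sgemb_const mpolyCM.
Qed.

HB.instance Definition _ :=
  GRing.isZmodMorphism.Build K R sgconst sgconst_zmod_morphism.
HB.instance Definition _ :=
  GRing.isMonoidMorphism.Build K R sgconst sgconst_monoid_morphism.

(** Outside [T] the value is the default [0]. *)
Definition sgmono (s : N2) : R := insubd 0 'X_[monomial_of s].

Lemma sgemb_mono s : s \in T -> sgemb (sgmono s) = 'X_[monomial_of s].
Proof.
move=> sT; rewrite /sgemb insubdK //; apply/supported_inP => m.
rewrite mcoeffX; case: (eqVneq (monomial_of s) m) => [<- _|_].
  by rewrite monomial_ofK.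
by rewrite eqxx.
Qed.

Lemma sgmonoD s t : s \in T -> t \in T -> sgmono (s + t) = sgmono s * sgmono t.
Proof.
move=> sT tT; apply: sgemb_inj; rewrite rmorphM /= !sgemb_mono ?rpredD //.
by rewrite monomial_ofD mpolyXD.
Qed.

Lemma sgmono0 : sgmono 0 = 1.
Proof.
apply: sgemb_inj; rewrite sgemb_mono ?rpred0 // rmorph1 -mpolyX0.
by congr mpolyX; apply/mnmP => i; rewrite mnmE mnm0E; case: ifP.
Qed.

Lemma sgmonoMn s k : s \in T -> sgmono (s *+ k) = sgmono s ^+ k.
Proof.
move=> sT; elim: k => [|k IH]; first by rewrite sgmono0.
by rewrite mulrS exprS sgmonoD ?IH // rpredMn.
Qed.

Lemma sgmono_neq0 s : s \in T -> sgmono s != 0.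
Proof.
move=> sT; apply/eqP => /(congr1 sgemb); rewrite sgemb_mono // rmorph0.
move=> /(congr1 (mcoeff (monomial_of s))); rewrite mcoeffX eqxx mcoeff0.
by apply/eqP/oner_neq0.
Qed.

Lemma sg_sum (f : R) : f = \sum_(m <- msupp (sgemb f))
  sgconst (sgemb f)@_m * sgmono (mexponent m).
Proof.
apply: sgemb_inj; rewrite [LHS]mpolyE rmorph_sum /= !big_seq.
apply: eq_bigr => m mf; rewrite rmorphM /= sgemb_const mul_mpolyC.
by rewrite sgemb_mono ?mexponentK //; apply: (@sgembP f); rewrite -mcoeff_msupp.
Qed.

Lemma sg_ind (P : R -> Prop) : P 0 ->
    (forall c s, s \in T -> P (sgconst c * sgmono s)) ->
    (forall x y, P x -> P y -> P (x + y)) ->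
  forall f, P f.
Proof.
move=> P0 Pm PD f; rewrite (sg_sum f) big_seq.
apply: big_ind => // m mf; apply: Pm.
by apply: (@sgembP f); rewrite -mcoeff_msupp.
Qed.

Lemma sg_dependence3 (x y z : R) : exists F : {poly {poly {poly K}}},
  F != 0 /\ eval_at (eval_at (eval_at sgconst x) y) z F = 0.
Proof.
have [N [c [[i [j [k cijk]]] c0]]] :=
  algebraic_dependence3 (sgemb x) (sgemb y) (sgemb z).
pose F := \poly_(k < N) \poly_(j < N) \poly_(i < N) c i j k.
exists F; split.
  apply: contraNneq cijk => /(congr1 (fun F : {poly {poly {poly K}}} => F`_k`_j`_i)).
  by rewrite !coef0 coef_poly ltn_ord coef_poly ltn_ord coef_poly ltn_ord => ->.
rewrite (eval_atE _ _ (size_poly N _)).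
under eq_bigr => k' _.
  rewrite /= coef_poly ltn_ord (eval_atE _ _ (size_poly N _)).
  under eq_bigr => j' _.
    rewrite /= coef_poly ltn_ord (eval_atE _ _ (size_poly N _)).
    under eq_bigr => i' _ do rewrite /= coef_poly ltn_ord.
    over.
  over.
apply: sgemb_inj; rewrite rmorph0 -[RHS]c0 rmorph_sum.
under [RHS]eq_bigr => i' _ do rewrite exchange_big.
rewrite /= exchange_big; apply: eq_bigr => k' _.
rewrite rmorphM rmorph_sum exchange_big mulr_suml; apply: eq_bigr => j' _.
rewrite rmorphM rmorph_sum !mulr_suml; apply: eq_bigr => i' _.
by rewrite !(rmorphM, rmorphXn) /= sgemb_const -!mulrA mul_mpolyC.
Qed.

(* Successive nonzerodivisors modulo an increasing chain of ideals are
   algebraically independent over [K]. *)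
Lemma sg_no_independent3 (I : nat -> R -> Prop) (x : nat -> R) :
    (forall i, (i <= 3)%N -> ideal_prop (I i)) -> ~ I 3%N 1 ->
    (forall i y, (i < 3)%N -> I i y -> I i.+1 y) ->
    (forall i, (i < 3)%N -> I i.+1 (x i)) ->
    (forall i w, (i < 3)%N -> I i (x i * w) -> I i w) -> False.
Proof.
move=> idI I1 sub mem reg.
(* The outermost variable goes to [x 0]. Variables are peeled off from the outside: [x 0] modulo
   [I 0], [x 1] modulo [I 1], [x 2] modulo [I 2]; then [I 3] contains no nonzero constant. *)
have [F [F0 F_eq0]] := sg_dependence3 (x 2) (x 1) (x 0).
have step0 c : I 3 (sgconst c) -> c = 0.
  move=> Ic; apply/eqP/negPn/negP => c0; apply: I1.
  by rewrite -(rmorph1 sgconst) -(mulVf c0) rmorphM; apply: ideal_mull => //; apply: idI.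
have step1 := eval_at_inj_mod (idI 3%N isT) (sub 2%N ^~ isT) (mem 2%N isT)
  (reg 2%N ^~ isT) step0.
have step2 := eval_at_inj_mod (idI 2%N isT) (sub 1%N ^~ isT) (mem 1%N isT)
  (reg 1%N ^~ isT) step1.
have step3 := eval_at_inj_mod (idI 1%N isT) (sub 0%N ^~ isT) (mem 0%N isT)
  (reg 0%N ^~ isT) step2.
by case/eqP: F0; apply: step3; rewrite F_eq0; apply: ideal_zero; apply: idI.
Qed.

(** An element of [P i.+1] outside the prime [P i] is a nonzerodivisor modulo [P i]. *)
Lemma sg_prime_chain_le2 l (P : nat -> {pred R}) : prime_chain l P -> (l <= 2)%N.
Proof.
move=> [primeP strictP]; rewrite leqNgt; apply/negP => l2.
have /choice[x xP] i : exists y, (i < 3)%N -> y \in P i.+1 /\ y \notin P i.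
  case: (ltnP i 3) => i3; last by exists 0.
  have [_] := strictP i (leq_trans i3 l2); apply: contra_notP => nx y yP.
  by apply/negPn/negP => yi; apply: nx; exists y.
have prime3 i : (i <= 3)%N -> prime_ideal (P i).
  by move=> i3; apply: primeP; apply: leq_trans l2.
apply: (@sg_no_independent3 (fun i y => y \in P i) x).
- by move=> i /prime3[/idealr_closed_ideal].
- by have [[_ /negP]] := prime3 3%N isT.
- by move=> i y i3; have [+ _] := strictP i (leq_trans i3 l2); apply.
- by move=> i /(xP i)[].
move=> i w i3; have [_ Pp] := prime3 i (ltnW i3).
by move=> /Pp; rewrite (negbTE (xP i i3).2).
Qed.

Lemma sg_regular_le2 (s : seq R) : regular_sequence s -> (size s <= 2)%N.
Proof.
move=> [proper reg]; rewrite leqNgt; apply/negP => s2.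
have take_sub i y : (i < size s)%N ->
    in_ideal_span (take i s) y -> in_ideal_span (take i.+1 s) y.
  move=> si; apply: ideal_span_sub; first exact: ideal_span_ideal.
  move=> z zs; apply: mem_ideal_span.
  by rewrite (take_nth 0) // mem_rcons inE zs orbT.
apply: (@sg_no_independent3 (fun i => in_ideal_span (take i s)) (nth 0 s)).
- by move=> i _; apply: ideal_span_ideal.
- move=> s1; apply: proper; apply: ideal_span_sub s1.
    exact: ideal_span_ideal.
  by move=> y /mem_take ys; apply: mem_ideal_span.
- by move=> i y i3; apply: take_sub; apply: leq_trans s2.
- move=> i i3; apply: mem_ideal_span.
  by rewrite (take_nth 0) ?mem_rcons ?mem_head // (leq_trans i3).
by move=> i w i3; apply: reg; apply: leq_trans s2.
Qed.

(** Three elements [u], [v], [f] are dependent. Without such a [G], factoring powers of the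
    nonzerodivisor [f] out of the relation would make all its coefficients vanish. *)
Lemma sg_relation (m : R -> Prop) (u v f : R) :
    ideal_prop m -> m f -> f != 0 ->
  exists G, G != 0 /\ m (eval_at (eval_at sgconst u) v G).
Proof.
move=> idm mf f0; apply: contrapT => nG.
have [F [F0 F_eq0]] := sg_dependence3 u v f.
case/eqP: F0; apply: (@eval_at_inj_mod _ _ (eval_at (eval_at sgconst u) v) f
  (fun y => y = 0) m) => //.
- by move=> y ->; apply: ideal_zero.
- by move=> w fw; apply: sg_mulf_eq0 fw f0.
by move=> b mb; apply/eqP/negPn/negP => b0; apply: nG; exists b.
Qed.

End SemigroupRingTheory.

(** * The Cohen-Macaulay property *)

Section Bivariate.
Variable K : fieldType.

(** The first variable becomes the inner one and the second the outer one, so [p(u)] is a constant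
    polynomial and [q(v)] has scalar coefficients. *)
Definition bivariate : {mpoly K[2]} -> {poly {poly K}} :=
  mmap (polyC \o polyC) (fun i => if i == ord0 then 'X%:P else 'X).
HB.instance Definition _ := GRing.RMorphism.copy bivariate bivariate.

Lemma bivariateC c : bivariate c%:MP = c%:P%:P.
Proof. exact: mmapC. Qed.

Lemma bivariateX s : bivariate 'X_[monomial_of s] = ('X^(s.1))%:P * 'X^(s.2).
Proof.
rewrite /bivariate mmapX /mmap1 !big_ord_recl big_ord0 mulr1.
by rewrite !mnmE /= rmorphXn.
Qed.

Lemma coef_bivariate p i j : (bivariate p)`_j`_i = p@_(monomial_of (i, j)).
Proof.
elim/mpolyind: p => [|c m p _ _ IH].
  by rewrite rmorph0 !coef0 mcoeff0.
rewrite mcoeffD rmorphD !coefD IH; congr (_ + _).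
rewrite -mul_mpolyC mcoeffCM rmorphM /= bivariateC -[m]mexponentK bivariateX.
rewrite !coefCM coefXn mcoeffX; congr (_ * _).
have -> : (monomial_of (mexponent m) == monomial_of (i, j)) =
    (i == (mexponent m).1) && (j == (mexponent m).2).
  rewrite (can_eq monomial_ofK) eq_sym; case: (mexponent m) => a b.
  by rewrite xpair_eqE.
case: (j == _); last by rewrite mulr0 coef0 andbF.
by rewrite mulr1 coefXn andbT.
Qed.

Lemma bivariate_inj : injective bivariate.
Proof.
move=> p q pq; apply/mpolyP => m; rewrite -[m]mexponentK.
by case: (mexponent m) => i j; rewrite -!coef_bivariate pq.
Qed.

Lemma bivariate_surj F : exists p, bivariate p = F.
Proof.
have constP (c : {poly K}) : exists p, bivariate p = c%:P.
  elim/poly_ind: c => [|c a [p pc]]; first by exists 0; rewrite rmorph0.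
  exists (p * 'X_[monomial_of (1%N, 0%N)] + a%:MP).
  by rewrite rmorphD rmorphM /= bivariateX bivariateC pc mulr1 !rmorphD rmorphM.
elim/poly_ind: F => [|F c [p pF]]; first by exists 0; rewrite rmorph0.
have [q qc] := constP c; exists (p * 'X_[monomial_of (0%N, 1%N)] + q).
by rewrite rmorphD rmorphM /= bivariateX pF qc mul1r.
Qed.

(** The leading coefficient of [H^:P] is a nonzero scalar, so [P] divides that of [F]; subtract the
    leading term and induct on size. *)
Lemma dvd_const_mul (H P : {poly K}) (F G : {poly {poly K}}) :
  H != 0 -> H^:P * F = P%:P * G -> exists W, F = P%:P * W.
Proof.
move=> H0; move: {2}(size F) (leqnn (size F)) => n.
elim: n F G => [|n IH] F G.
  by rewrite size_poly_leq0 => /eqP -> _; exists 0; rewrite mulr0.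
move=> sF HF; pose a := (lead_coef H)^-1%:P * lead_coef G.
have lF : lead_coef F = P * a.
  have := congr1 lead_coef HF; rewrite !lead_coefM lead_coefC.
  rewrite lead_coef_map_inj //; last exact: polyC_inj.
  rewrite /a mulrCA => <-; rewrite mulrA -polyCM mulVf ?lead_coef_eq0 //.
  by rewrite mul1r.
pose F' := F - P%:P * (a%:P * 'X^((size F).-1)).
have [||W F'W] := IH F' (G - H^:P * (a%:P * 'X^((size F).-1))).
- apply/leq_sizeP => j nj; rewrite /F' mulrA -polyCM -lF coefB coefCM coefXn.
  case: eqVneq => [->|jF]; first by rewrite mulr1 subrr.
  rewrite mulr0 subr0 nth_default //; move: sF jF nj.
  by case: (size F) => [|k] //=; lia.
- by rewrite /F' !mulrBr HF; congr (_ - _); rewrite mulrCA.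
exists (W + a%:P * 'X^((size F).-1)).
by rewrite mulrDr -F'W /F' subrK.
Qed.

(** Take the last nonzero coefficient of [w] in the class of [i] modulo [D]: its product with the
    leading term of [P] cannot cancel. *)
Lemma coef_mul_comp_Xn (P w : {poly K}) D i : (0 < D)%N -> P != 0 -> w`_i != 0 ->
  exists k, ((P \Po 'X^D) * w)`_(i + k * D) != 0.
Proof.
move=> D0 P0 wi.
have ex0 : exists t, w`_(i + t * D) != 0 by exists 0%N; rewrite addn0.
have bnd t : w`_(i + t * D) != 0 -> (t <= size w)%N.
  apply: contraNT; rewrite -ltnNge => wt; rewrite nth_default //.
  apply: leq_trans (ltnW wt) _; apply: leq_trans (leq_addl i _).
  by rewrite leq_pmulr.
case: (ex_maxnP ex0 bnd) => t wt maxt.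
have sP : size P = (size P).-1.+1 by rewrite prednK // lt0n size_poly_eq0.
exists (t + (size P).-1)%N; rewrite comp_polyE mulr_suml coef_sum.
have lt_last : ((size P).-1 < size P)%N by rewrite -sP.
have cf a : (a < size P)%N -> (P`_a *: 'X^D ^+ a * w)`_(i + (t + (size P).-1) * D)
    = P`_a * w`_(i + (t + (size P).-1 - a) * D).
  move=> aP; rewrite -scalerAl coefZ -exprM coefXnM.
  have aP' : (a <= (size P).-1)%N by rewrite -ltnS -sP.
  have le : (D * a <= (t + (size P).-1) * D)%N.
    by rewrite mulnC leq_mul2r (leq_trans aP') ?orbT // leq_addl.
  rewrite ltnNge (leq_trans le (leq_addl _ _)) /= -addnBA //.
  by rewrite (mulnC D) mulnBl.
rewrite (bigD1 (Ordinal lt_last)) //= cf // addnK big1 ?addr0.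
  by rewrite mulf_eq0 negb_or wt andbT -lead_coefE lead_coef_eq0.
move=> a na; rewrite cf //; apply/eqP; rewrite mulf_eq0; apply/orP; right.
have aP' : (a < (size P).-1)%N.
  by rewrite ltn_neqAle -ltnS -sP ltn_ord andbT; rewrite -val_eqE in na.
apply: contraTT aP' => /maxt; lia.
Qed.

End Bivariate.

Section CohenMacaulay.
Variables (K : fieldType) (T : addrClosed N2) (D : nat).
Local Notation R := (semigroup_ring K T).
Hypothesis D_gt0 : (0 < D)%N.
Hypothesis D0T : (D, 0%N) \in T.
Hypothesis D1T : (0%N, D) \in T.
Hypothesis TE : forall i j, (i + D, j)%N \in T -> (i, j + D)%N \in T -> (i, j) \in T.

Local Notation u := (sgmono K T (D, 0%N)).
Local Notation v := (sgmono K T (0%N, D)).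

Lemma bivariate_eval_u p :
  bivariate (sgemb (eval_at (@sgconst K T) u p)) = (p \Po 'X^D)%:P.
Proof.
elim/poly_ind: p => [|p c IH]; first by rewrite comp_poly0 rmorph0 sgemb0 !rmorph0.
rewrite comp_poly_MXaddC eval_at_MXaddC sgembD sgembM !(rmorphD, rmorphM) /= IH.
by rewrite sgemb_mono // sgemb_const bivariateX bivariateC mulr1.
Qed.

Lemma bivariate_eval_v p :
  bivariate (sgemb (eval_at (@sgconst K T) v p)) = (p \Po 'X^D)^:P.
Proof.
elim/poly_ind: p => [|p c IH]; first by rewrite comp_poly0 rmorph0 sgemb0 !rmorph0.
rewrite comp_poly_MXaddC eval_at_MXaddC sgembD sgembM !(rmorphD, rmorphM) /= IH.
rewrite sgemb_mono // sgemb_const bivariateX bivariateC mul1r.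
by rewrite map_polyXn map_polyC.
Qed.

Lemma eval_u_neq0 p : p != 0 -> eval_at (@sgconst K T) u p != 0.
Proof.
apply: contraNneq => /(congr1 (@bivariate K \o @sgemb K T)) /=.
rewrite bivariate_eval_u !rmorph0 => /polyC_inj/eqP.
by rewrite comp_poly_eq0 // size_polyXn ltnS.
Qed.

(** The inner induction removes the [l] shifts when [k] is one; the outer one lowers [k]. *)
Lemma semigroup_saturated k l i j :
  (i + k * D, j)%N \in T -> (i, j + l * D)%N \in T -> (i, j) \in T.
Proof.
have addT a b c d : (a, b) \in T -> (c, d) \in T -> (a + c, b + d)%N \in T.
  exact: rpredD.
have addu a b n : (a, b) \in T -> (a + n * D, b)%N \in T.
  move=> ab; elim: n => [|n IH]; first by rewrite addn0.
  by have := addT _ _ _ _ IH D0T; rewrite addn0 mulSn -addnA (addnC (n * D)%N).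
have step : forall l i j,
    (i + D, j)%N \in T -> (i, j + l * D)%N \in T -> (i, j) \in T.
  move=> {k l i j}; elim=> [|l IH] i j iD; first by rewrite addn0.
  rewrite mulSn addnCA addnC => jl; apply: (IH _ _ iD); apply: TE => //.
  have {}addv a b n : (a, b) \in T -> (a, b + n * D)%N \in T.
    move=> ab; elim: n => [|n IHn]; first by rewrite addn0.
    by have := addT _ _ _ _ IHn D1T; rewrite addn0 mulSn -addnA (addnC (n * D)%N).
  exact: addv.
elim: k => [|k IH]; first by rewrite addn0.
move=> ik jl; apply: IH => //; apply: (step l); last exact: addu.
by rewrite -addnA (addnC _ D) -mulSn.
Qed.

(** In [K[x, y]], [f = p(u) W] and [g = h(v) W]. An exponent of [W] shifted along the first axis
    occurs in [f], and shifted along the second in [g], so saturation puts it in [T]. *)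
Lemma eval_regular p h (f g : R) : p != 0 -> h != 0 ->
    eval_at (@sgconst K T) v h * f = eval_at (@sgconst K T) u p * g ->
  exists w, f = eval_at (@sgconst K T) u p * w.
Proof.
have compX (q : {poly K}) : q != 0 -> q \Po 'X^D != 0.
  by apply: contraNneq => /eqP; rewrite comp_poly_eq0 ?size_polyXn ?ltnS.
move=> p0 h0 hfpg; have := congr1 (@bivariate K \o @sgemb K T) hfpg.
rewrite /= !sgembM !rmorphM /= bivariate_eval_u bivariate_eval_v => bhfpg.
have [W fW] := dvd_const_mul (compX h h0) bhfpg.
have gW : bivariate (sgemb g) = (h \Po 'X^D)^:P * W.
  apply: (mulfI (x := (p \Po 'X^D)%:P)); first by rewrite polyC_eq0 compX.
  by rewrite -bhfpg fW mulrCA.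
have [w' w'W] := bivariate_surj W.
have bivT (x : R) i j : (bivariate (sgemb x))`_j`_i != 0 -> (i, j) \in T.
  by rewrite coef_bivariate => /sgembP; rewrite monomial_ofK.
have [m|w ww'] := @sgemb_surj K T w'.
  rewrite -[m]mexponentK; case: (mexponent m) => i j.
  rewrite -coef_bivariate w'W monomial_ofK => Wij.
  have [k uk] := coef_mul_comp_Xn D_gt0 p0 Wij.
  have Wji : (swapXY W)`_i`_j != 0 by rewrite coef_swapXY.
  have [l vl] := coef_mul_comp_Xn D_gt0 h0 Wji.
  apply: (@semigroup_saturated k l).
    by apply: (bivT f); rewrite fW coefCM.
  apply: (bivT g); rewrite gW -coef_swapXY rmorphM /= swapXY_map_polyC coefCM //.
exists w; apply: sgemb_inj; apply: bivariate_inj.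
by rewrite fW sgembM rmorphM /= bivariate_eval_u ww' w'W.
Qed.

Section MaximalIdeal.
Variable m : {pred R}.
Hypothesis maxm : maximal_ideal m.
Variables (p h : {poly K}).
Hypotheses (p0 : p != 0) (h0 : h != 0).
Hypothesis pm : eval_at (@sgconst K T) u p \in m.
Hypothesis hm : eval_at (@sgconst K T) v h \in m.

Let idm : ideal_prop (fun x => x \in m) := idealr_closed_ideal maxm.1.

Lemma maximal_depth2 : depth_eq m 2.
Proof.
split; last by move=> s regs _; apply: sg_regular_le2.
exists [:: eval_at (@sgconst K T) u p; eval_at (@sgconst K T) v h]; split=> //.
  split.
    move=> /(ideal_span_sub idm) m1; have [[_ /negP + _] _] := maxm; apply.
    by apply: m1 => y; rewrite !inE => /orP[] /eqP ->.
  case=> [|[|//]] _ x /=.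
    move=> [c]; rewrite big_ord0 => /sg_mulf_eq0 x0.
    by exists c; rewrite big_ord0 x0 // eval_u_neq0.
  move=> [c]; rewrite big_ord1 /= mulrC => hx.
  rewrite mulrC in hx; rewrite [RHS]mulrC in hx.
  have [w ->] := eval_regular p0 h0 hx.
  by exists (fun=> w); rewrite big_ord1 mulrC.
by move=> y; rewrite !inE => /orP[] /eqP ->.
Qed.

Lemma maximal_height2 : height_eq m 2.
Proof.
split; last by move=> l P /sg_prime_chain_le2.
have primem := maximal_ideal_prime maxm.
(* [U] contains the complement of [m] and every nonzero [q(v)], so a prime [Q] over [p(u)] missing
   [U] lies in [m] and omits [h(v)]: the chain [0], [Q], [m] is strict. *)
pose I x := exists w, x = eval_at (@sgconst K T) u p * w.
pose U x := exists w q, [/\ w \notin m, q != 0 & x = eval_at (@sgconst K T) v q * w].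
have m1 : 1 \notin m by case: primem => -[].
have [||||Q [primeQ IQ QU]] := @exists_prime_avoiding R I U.
- split; first by exists 0; rewrite mulr0.
  by move=> a _ _ [x ->] [y ->]; exists (a * x + y); ring.
- by exists 1, 1; rewrite oner_neq0 rmorph1 mulr1.
- move=> _ _ [x [q [xm q0 ->]]] [y [q' [ym q'0 ->]]].
  exists (x * y), (q * q'); rewrite mulf_neq0 // rmorphM; split=> //; last by ring.
  by apply/negP => /primem.2; rewrite (negbTE xm) (negbTE ym).
(* From [p(u) w = q(v) y], regularity makes [p(u)] divide [y], which puts [y] in [m]. *)
- move=> _ [w ->] [y [q [ym q0 e]]]; case/negP: ym.
  have [z ->] := eval_regular p0 q0 (esym e).
  exact: (ideal_mulr idm).
exists (fun i => if i is i'.+1 then if i' is 0 then Q else m else fun x => x == 0).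
split=> //; split=> [[|[|[|//]]]|[|[|//]]] _ //.
- exact: sg_zero_prime.
- have [[Q0 _ _] _] := primeQ.
  split=> [x|Q0'].
    by rewrite unfold_in => /eqP ->.
  case/negP: (eval_u_neq0 p0); apply: Q0'.
  by apply: IQ; exists 1; rewrite mulr1.
- split=> [x xQ|mQ].
    apply/negPn/negP => xm; apply: (QU x xQ).
    by exists x, 1; rewrite rmorph1 mul1r oner_neq0.
  by apply: (QU _ (mQ _ hm)); exists 1, h; rewrite mulr1.
Qed.

End MaximalIdeal.

Section FiniteGenerators.
Variables (J : finType) (E : J -> N2).
Hypothesis ET : forall j, E j \in T.

(** The translates of the [E j] by multiples of [a] and [b] cover [T], so the ring is a finite
    module over the subalgebra generated by the two monomials. *)
Lemma eval_generators (a b : N2) : a \in T -> b \in T ->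
    (forall s, s \in T -> exists j k l, s = E j + a *+ k + b *+ l) ->
  forall x : R, exists p : J -> {poly {poly K}}, x = \sum_j
    eval_at (eval_at (@sgconst K T) (sgmono K T a)) (sgmono K T b) (p j)
      * sgmono K T (E j).
Proof.
move=> aT bT gen; apply: sg_ind => [|c s /gen[j [k [l ->]]]|_ _ [p ->] [q ->]].
- by exists (fun=> 0); rewrite big1 // => j _; rewrite rmorph0 mul0r.
- exists (fun j' => if j' == j then (c%:P * 'X^k)%:P * 'X^l else 0).
  rewrite (bigD1 j) //= eqxx big1 ?addr0 => [|j' /negbTE ->]; last first.
    by rewrite rmorph0 mul0r.
  rewrite rmorphM rmorphXn /= eval_atX eval_atC rmorphM rmorphXn /=.
  rewrite eval_atX eval_atC !sgmonoD ?rpredD ?rpredMn ?ET //.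
  by rewrite !sgmonoMn //; ring.
exists (fun j => p j + q j); rewrite -big_split.
by apply: eq_bigr => j _; rewrite rmorphD mulrDl.
Qed.

Hypothesis gen : forall s, s \in T ->
  exists j k l, s = E j + (D, 0%N) *+ k + (0%N, D) *+ l.

Lemma semigroup_ring_cohen_macaulay : noetherian R -> cohen_macaulay R.
Proof.
move=> noeR; split=> // m maxm.
have idm := idealr_closed_ideal maxm.1.
have m1 : 1 \notin m by case: maxm.1.
(* [m] is nonzero: it contains [u] or some [z * u - 1], and the latter takes the value [-1] at the
   origin. *)
have [f [fm f0]] : exists f, f \in m /\ f != 0.
  apply: contrapT => nf.
  pose aug (x : R) := (bivariate (sgemb x)).[0].[0].
  have augu : aug u = 0.
    by rewrite /aug sgemb_mono // bivariateX mulr1 !hornerE expr0n; case: D D_gt0.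
  have [|um] := pselect (u \in m).
    by move=> um; apply: nf; exists u; rewrite sgmono_neq0.
  have [//|[z zu]] := maximal_ideal_inverse u maxm.
  apply: nf; exists (z * u - 1); split=> //.
  rewrite subr_eq0; apply/eqP => /(congr1 aug)/eqP.
  rewrite {1}/aug sgembM rmorphM !hornerM -/(aug u) augu mulr0.
  by rewrite /aug !rmorph1 !hornerE eq_sym oner_eq0.
have maxP x : x \in m \/ (exists z, z * x - 1 \in m).
  exact: maximal_ideal_inverse.
(* The contraction argument runs twice with [u] and [v] exchanged, giving [p(u)] and [h(v)] in
   [m]. *)
have [Gu [Gu0 Gum]] := sg_relation u v idm fm f0.
have [Gv [Gv0 Gvm]] := sg_relation v u idm fm f0.
have gen' s : s \in T -> exists j k l, s = E j + (0%N, D) *+ k + (D, 0%N) *+ l.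
  by move=> /gen[j [k [l ->]]]; exists j, l, k; rewrite addrAC.
have [p [p0 pm]] :=
  maximal_contraction idm maxP (eval_generators D0T D1T gen) Gu0 Gum.
have [h [h0 hm]] :=
  maximal_contraction idm maxP (eval_generators D1T D0T gen') Gv0 Gvm.
by exists 2%N; split; [exact: maximal_height2 pm hm | exact: maximal_depth2 pm hm].
Qed.

End FiniteGenerators.
End CohenMacaulay.

(** * Finitely generated semigroups *)

Section Generated.
Variables (K : fieldType) (A : seq N2).
Local Notation T := (generated_semigroup A).
Local Notation R := (semigroup_ring K T).

Lemma mem_generated s : s \in A -> s \in T.
Proof.
move=> sA; have si : (index s A < size A)%N by rewrite index_mem.
apply/asboolP; exists (fun i => (i == Ordinal si) : nat).
rewrite (bigD1 (Ordinal si)) //= eqxx mulr1n nth_index // big1 ?addr0 //.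
by move=> i /negbTE ->.
Qed.

Lemma generated_ind (P : N2 -> Prop) : P 0 -> (forall s, s \in A -> P s) ->
    (forall s t, s \in T -> t \in T -> P s -> P t -> P (s + t)) ->
  forall s, s \in T -> P s.
Proof.
move=> P0 PA PD s /asboolP[c ->].
have [] : (\sum_(i < size A) A`_i *+ c i \in T) /\ P (\sum_(i < size A) A`_i *+ c i) => //.
apply: (big_ind (fun s => s \in T /\ P s)) => [|x y [xT Px] [yT Py]|i _].
- by split=> //; apply: rpred0.
- by split; [apply: rpredD | apply: PD].
have AT : A`_i \in T by apply/mem_generated/mem_nth.
elim: (c i) => [|k [kT Pk]]; first by split=> //; apply: rpred0.
rewrite mulrS; split; first exact: rpredD.
by apply: PD => //; apply: PA; apply: mem_nth.
Qed.

Lemma semigroup_ring_noetherian : noetherian R.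
Proof.
apply: (@noetherian_finitely_generated K R (@sgconst K T) [seq sgmono K T s | s <- A]).
move=> P PC PA PD PM; apply: sg_ind => [|c s sT|//].
  by rewrite -(rmorph0 (@sgconst K T)); apply: PC.
apply: (PM); first exact: PC.
move: s sT; apply: generated_ind => [|s sA|s t sT tT Ps Pt].
- by rewrite sgmono0 -(rmorph1 (@sgconst K T)); apply: PC.
- by apply/PA/map_f.
by rewrite sgmonoD //; apply: PM.
Qed.

Lemma pair_addn (a b a' b' : nat) :
  (a, b) + (a', b') = (a + a', b + b')%N :> N2.
Proof. by []. Qed.

Lemma pair_mulrn (a b k : nat) : (a, b) *+ k = (a * k, b * k)%N :> N2.
Proof. by elim: k => [|k IH]; rewrite ?muln0 // mulrS IH !mulnS. Qed.

(* Every element is congruent modulo [(D, 0)] and [(0, D)] to a combination of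
   the generators with coefficients less than [D]. *)
Lemma generated_cohen_macaulay D : (0 < D)%N ->
    (D, 0%N) \in T -> (0%N, D) \in T ->
    (forall i j, (i + D, j)%N \in T -> (i, j + D)%N \in T -> (i, j) \in T) ->
  cohen_macaulay R.
Proof.
move=> D0 D0T D1T TE.
pose E (c : {ffun 'I_(size A) -> 'I_D}) := \sum_(i < size A) A`_i *+ c i.
apply: (@semigroup_ring_cohen_macaulay K T D D0 D0T D1T TE _ E).
- by move=> c; apply/asboolP; exists (fun i => c i : nat).
- move=> s /asboolP[c ->].
  pose a (i : 'I_(size A)) : N2 := A`_i.
  exists [ffun i => Ordinal (ltn_pmod (c i) D0)].
  (* [D] copies of [(x, y)] amount to [x] copies of [(D, 0)] and [y] copies of [(0, D)]. *)
  exists (\sum_(i < size A) (a i).1 * (c i %/ D))%N.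
  exists (\sum_(i < size A) (a i).2 * (c i %/ D))%N.
  rewrite -addrA -!sumrMnr -big_split -big_split /=.
  apply: eq_bigr => i _; rewrite ffunE /= {1}(divn_eq (c i) D).
  rewrite -/(a i); case: (a i) => x y /=; rewrite !pair_mulrn.
  by congr pair; rewrite /= ?mul0n ?addn0; lia.
exact: semigroup_ring_noetherian.
Qed.

End Generated.

(** * Dimension *)

Section Dimension.
Variables (K : fieldType) (T : addrClosed N2) (D : nat).
Local Notation R := (semigroup_ring K T).
Hypothesis D_gt0 : (0 < D)%N.
Hypothesis D0T : (D, 0%N) \in T.
Hypothesis D1T : (0%N, D) \in T.

Lemma semigroup_ring_dim2 : ring_krull_dim_eq R 2.
Proof.
split; last by move=> l P /sg_prime_chain_le2.
(* [f1] sets the second variable to [0] and [f2] sets both. The kernels are strictly nested: [v] is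
   killed by [f1], and [u] by [f2] but not by [f1]. *)
pose f1 : R -> {poly K} := horner_eval 0 \o (@bivariate K \o @sgemb K T).
pose f2 : R -> K := horner_eval 0 \o f1.
exists (fun i => match i with
  0 => fun x => x == 0 | 1 => fun x => f1 x == 0 | _ => fun x => f2 x == 0 end).
have X0 : (0 : K) ^+ D = 0 by rewrite expr0n gtn_eqF.
split; last by move=> x <-; rewrite unfold_in.
split=> [[|[|[|//]]]|[|[|//]]] _.
- exact: sg_zero_prime.
- exact: (domain_prime_kernel f1).
- exact: (domain_prime_kernel f2).
- split=> [x|sub]; first by rewrite !unfold_in => /eqP ->; rewrite /f1 /= sgemb0 !rmorph0.
  have /negP := sgmono_neq0 K D1T; apply; apply: sub.
  rewrite unfold_in /f1 /= sgemb_mono // bivariateX mul1r /horner_eval hornerXn.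
  by rewrite expr0n gtn_eqF.
split=> [x|sub]; first by rewrite !unfold_in /f2 /= => /eqP ->; rewrite rmorph0.
have : f1 (sgmono K T (D, 0%N)) == 0.
  apply: sub; rewrite unfold_in /f2 /f1 /= sgemb_mono // bivariateX mulr1.
  by rewrite /horner_eval hornerC hornerXn X0.
rewrite /f1 /= sgemb_mono // bivariateX mulr1 /horner_eval hornerC.
by rewrite -size_poly_eq0 size_polyXn.
Qed.

Lemma mulrn_axes (s : N2) : s *+ D = (D, 0%N) *+ s.1 + (0%N, D) *+ s.2.
Proof.
case: s => a b; rewrite !pair_mulrn /= !mul0n.
by rewrite pair_addn addn0 add0n !(mulnC D).
Qed.

Lemma semigroup_simplicial : simplicial T.
Proof.
exists [:: (D, 0%N); (0%N, D)]; split.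
- by move=> s; rewrite !inE => /orP[] /eqP ->.
- apply/row_freeP; exists (D%:R^-1)%:M.
  apply/matrixP => i j; rewrite mul_mx_scalar !mxE.
  have D0 : (D%:R : rat) != 0 by rewrite Num.Theory.pnatr_eq0 -lt0n.
  by case: i => [[|[|//]] ?]; case: j => [[|[|//]] ?] /=; rewrite ?mulr0 ?mulVf.
move=> s _; exists D => //; apply/asboolP.
exists (fun i => if i == ord0 then s.1 else s.2).
by rewrite !big_ord_recl big_ord0 /= addr0 mulrn_axes.
Qed.

Lemma annihilator_mono (T' : addrClosed N2) a :
    a \in T -> (forall s, s \in T' -> a + s \in T) ->
  @quotient_annihilator K T T' (sgmono K T a).
Proof.
move=> aT aT' g; apply/supported_inP => m; rewrite -mcoeff_msupp.
move=> /msuppM_le/allpairsP[[m1 m2] /= [m1a m2g ->]].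
have -> : mexponent (m1 + m2)%MM = mexponent m1 + mexponent m2.
  by rewrite /mexponent !mnmDE.
move: m1a; rewrite -[sgval _]/(sgemb _) sgemb_mono // msuppX inE => /eqP ->.
by rewrite monomial_ofK; apply: aT'; apply: (allP (sgvalP g)).
Qed.

Lemma prime_ideal_exp (Q : {pred R}) x k : prime_ideal Q -> x ^+ k \in Q -> x \in Q.
Proof.
move=> [[_ /negP Q1 _] Qp]; elim: k => [//|k IH].
by rewrite exprS => /Qp/orP[|/IH].
Qed.

(* Only the irrelevant maximal ideal contains powers of both [x^D] and [y^D]. *)
Lemma quotient_dim0 (T' : addrClosed N2) k :
    (forall s, s \in T' -> (D, 0%N) *+ k + s \in T) ->
    (forall s, s \in T' -> (0%N, D) *+ k + s \in T) ->
  krull_dim_le (@quotient_annihilator K T T') 0.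
Proof.
move=> uT vT [//|l] P [primeP strictP] annP; exfalso.
have prime0 := primeP 0%N isT; have id0 := idealr_closed_ideal prime0.1.
have axis a : a \in T -> (forall s, s \in T' -> a *+ k + s \in T) ->
    sgmono K T a \in P 0%N.
  move=> aT akT; apply: (prime_ideal_exp (k := k) prime0).
  by rewrite -sgmonoMn //; apply/annP/annihilator_mono => //; apply: rpredMn.
have uP := axis _ D0T uT; have vP := axis _ D1T vT.
have monoP s : s \in T -> s != 0 -> sgmono K T s \in P 0%N.
  move=> sT s0; apply: (prime_ideal_exp (k := D) prime0).
  rewrite -sgmonoMn // mulrn_axes sgmonoD ?rpredMn // !sgmonoMn //.
  case: s s0 {sT} => [[|a] [|b]] //= _.
  - by rewrite exprS; apply: (ideal_mull id0); apply: (ideal_mulr id0).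
  - by rewrite exprS -mulrA; apply: (ideal_mulr id0).
  by rewrite exprS -mulrA; apply: (ideal_mulr id0).
(* Every monomial except [1] lies in [P 0], so the quotient is [K], and a larger ideal would contain
   a nonzero constant. *)
have constP (x : R) : exists c, x - sgconst T c \in P 0%N.
  elim/sg_ind: x => [|c s sT|x y [c xc] [c' yc']].
  - by exists 0; rewrite rmorph0 subr0; apply: (ideal_zero id0).
  - have [->|s0] := eqVneq s 0.
      by exists c; rewrite sgmono0 mulr1 subrr; apply: (ideal_zero id0).
    by exists 0; rewrite rmorph0 subr0; apply: (ideal_mull id0); apply: monoP.
  by exists (c + c'); rewrite rmorphD opprD addrACA; apply: (ideal_add id0).
have [sub01] := strictP 0%N isT; apply=> x x1.
have [[_ /negP one1 _] _] := primeP 1%N isT.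
have id1 := idealr_closed_ideal (primeP 1%N isT).1.
have [c xc] := constP x.
have [c0|c0] := eqVneq c 0; first by move: xc; rewrite c0 rmorph0 subr0.
case: one1; rewrite -(rmorph1 (@sgconst K T)) -(mulVf c0) rmorphM.
apply: (ideal_mull id1); rewrite /= -[sgconst T c](subKr x).
by apply: (ideal_sub id1) => //; apply: sub01.
Qed.

End Dimension.

(** * The semigroups of the curve *)

Section ArithmeticSequence.
Variables (n m1 d : nat).
Hypotheses (n_gt1 : (1 < n)%N) (m1_gt0 : (0 < m1)%N) (d_gt0 : (0 < d)%N).

Local Notation D := (arith_term m1 d n).
Local Notation S := (curve_semigroup n m1 d).
Local Notation point := (curve_point n m1 d).

Lemma arith_term_gt0 i : (0 < arith_term m1 d i)%N.
Proof. by rewrite /arith_term addn_gt0 m1_gt0. Qed.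

Lemma arith_termE : D = (m1 + n.-1 * d)%N. Proof. by []. Qed.

Lemma curve_pointE i : (1 <= i <= n)%N ->
  point i = (m1 + i.-1 * d, (n - i) * d)%N.
Proof.
move=> /andP[i1 ilen]; rewrite /curve_point ltn_eqF ?ltnS //; congr pair.
by rewrite /arith_term subnDl -mulnBl; congr (_ * _)%N; lia.
Qed.

Lemma curve_point_last : point n.+1 = (0%N, D).
Proof. by rewrite /curve_point eqxx. Qed.

Lemma mem_curve_generators i : (1 <= i <= n.+1)%N ->
  point i \in curve_generators n m1 d.
Proof. by move=> i1; apply: map_f; rewrite mem_iota; lia. Qed.

Lemma curve_generatorsP s : s \in curve_generators n m1 d ->
  exists2 i, (1 <= i <= n.+1)%N & s = point i.
Proof. by move=> /mapP[i]; rewrite mem_iota => i1 ->; exists i => //; lia. Qed.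

(* [k] is the degree and [j] the number of summands with nonzero first
   coordinate. *)
Lemma curve_semigroupP x y : (x, y) \in S <-> exists k j i,
  [/\ x + y = k * D, x = j * m1 + i * d, j <= k & i <= j * n.-1]%N.
Proof.
split.
  pose P (s : N2) := exists k j i, [/\ s.1 + s.2 = k * D,
    s.1 = j * m1 + i * d, j <= k & i <= j * n.-1]%N.
  suff SP s : s \in S -> P s by move=> /SP.
  move: s; apply: generated_ind => [|s /curve_generatorsP[i i1 ->]|s t _ _].
  - by exists 0%N, 0%N, 0%N.
  - have [->|ni] := eqVneq i n.+1.
      by rewrite curve_point_last; exists 1%N, 0%N, 0%N; rewrite /= mul1n.
    have i2 : (1 <= i <= n)%N by lia.
    exists 1%N, 1%N, i.-1; rewrite curve_pointE //= !mul1n arith_termE.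
    split=> //; last by lia.
    by rewrite -addnA -mulnDl; congr (_ + _ * _)%N; lia.
  move=> [k [j [i [e1 e2 jk ij]]]] [k' [j' [i' [e1' e2' jk' ij']]]].
  exists (k + k')%N, (j + j')%N, (i + i')%N; rewrite !mulnDl /=.
  split; [|by rewrite e2 e2'; lia|exact: leq_add|exact: leq_add].
  by rewrite -e1 -e1'; case: (s) (t) => [? ?] [? ?] /=; lia.
move=> [k [j [i [e1 e2 jk ij]]]].
elim: k j i x y e1 e2 jk ij => [|k IH] j i x y e1 e2 jk ij.
  have -> : (x, y) = 0 by congr pair; lia.
  exact: rpred0.
have pT i' : (1 <= i' <= n.+1)%N -> point i' \in S.
  by move=> i1; apply/mem_generated/mem_curve_generators.
have bound j' i' : (i' <= j' * n.-1)%N -> (j' * m1 + i' * d <= j' * D)%N.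
  move=> ij'; rewrite arith_termE mulnDr leq_add2l mulnA.
  by rewrite leq_mul2r ij' orbT.
(* With [j <= k] some summand is [a_(n+1)] and can be split off; otherwise all [k + 1] summands have
   nonzero first coordinate. *)
have [jk'|kj] := leqP j k.
  have xk : (x <= k * D)%N.
    by rewrite e2 (leq_trans (bound _ _ ij)) // leq_mul2r jk' orbT.
  have yD : (D <= y)%N by move: e1; rewrite mulSn; lia.
  have -> : (x, y) = (x, y - D)%N + point n.+1.
    by rewrite curve_point_last pair_addn addn0 subnK.
  apply: rpredD; last by apply: pT; rewrite leqnn.
  by apply: (IH j i) => //; move: e1; rewrite mulSn; lia.
have jE : j = k.+1 by lia.
(* Split off the generator using as much of [i] as one summand allows, which leaves at most
   [k * n.-1]. *)
pose t := minn i n.-1.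
have tn : (1 <= t.+1 <= n)%N by rewrite /t; lia.
have ij' : (i - t <= k * n.-1)%N by move: ij; rewrite jE mulSn /t; set q := (k * _)%N; lia.
have xE : x = (k * m1 + (i - t) * d + (m1 + t * d))%N.
  by rewrite e2 jE mulSn -{1}(@subnK t i) ?geq_minl // mulnDl; lia.
have DE : D = (m1 + t * d + (n - t.+1) * d)%N.
  by rewrite arith_termE -addnA -mulnDl; congr (_ + _ * _)%N; lia.
have bnd := bound _ _ ij'.
have yle : ((n - t.+1) * d <= y)%N.
  by move: e1; rewrite mulSn {1}DE xE; lia.
have -> : (x, y) = (k * m1 + (i - t) * d, y - (n - t.+1) * d)%N + point t.+1.
  by rewrite curve_pointE // pair_addn /= -xE subnK.
apply: rpredD; last by apply: pT; lia.
by apply: (IH k (i - t)%N) => //; move: e1; rewrite mulSn {1}DE xE; lia.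
Qed.

Lemma curve_semigroup_saturated x y :
  (x + D, y)%N \in S -> (x, y + D)%N \in S -> (x, y) \in S.
Proof.
move=> /curve_semigroupP[k [j [i [e1 e2 jk ij]]]].
move=> /curve_semigroupP[k' [j' [i' [e1' e2' jk' ij']]]].
have D0 := arith_term_gt0 n.
have kk' : k' = k by apply/eqP; rewrite -(eqn_pmul2r D0) -e1 -e1'; apply/eqP; lia.
subst k'; apply/curve_semigroupP.
have k0 : (0 < k)%N by case: k e1 {jk jk' e1'} => // e1; move: D0 e1; lia.
have kE : (k * D = k.-1 * D + D)%N by rewrite -{1}(prednK k0) mulSn addnC.
have xy : (x + y = k.-1 * D)%N by move: e1; rewrite kE; lia.
have [jk1|kj] := leqP j' k.-1; first by exists k.-1, j', i'.
have jE : j' = k by lia.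
have ni : (n.-1 <= i)%N.
  rewrite -(leq_pmul2r d_gt0).
  have : (j * m1 <= k * m1)%N by rewrite leq_mul2r jk orbT.
  by move: e2; rewrite e2' jE arith_termE; lia.
have j0 : (0 < j)%N by rewrite lt0n; apply: contraTneq ij => ->; lia.
exists k.-1, j.-1, (i - n.-1)%N; split=> //; last first.
- by move: ij; rewrite -{1}(prednK j0) mulSn; lia.
- by lia.
have : (j * m1 = j.-1 * m1 + m1)%N by rewrite -{1}(prednK j0) mulSn addnC.
have : (i * d = (i - n.-1) * d + n.-1 * d)%N by rewrite -mulnDl subnK.
by move: e2; rewrite arith_termE; lia.
Qed.

(** * The semigroup without [a_r] *)

Section Puncture.
Variable r : nat.
Hypothesis r_bounds : (2 <= r <= n - 2)%N.
Local Notation P := (punctured_curve_semigroup n m1 d r).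

(** The filter compares values, so the points must be distinct: first coordinates strictly increase
    up to index [n], and that of [a_(n+1)] is [0]. *)
Lemma mem_punctured i : (1 <= i <= n.+1)%N -> i != r -> point i \in P.
Proof.
move=> i1 ir; apply: mem_generated; rewrite mem_filter mem_curve_generators // andbT.
have rn : (1 <= r <= n)%N by lia.
have [->|ni] := eqVneq i n.+1.
  by rewrite curve_point_last curve_pointE // xpair_eqE eq_sym addn_eq0 gtn_eqF.
rewrite !curve_pointE ?xpair_eqE; [|lia|lia].
by rewrite eqn_add2l eqn_pmul2r //; lia.
Qed.

Lemma punctured_sub : {subset P <= S}.
Proof.
apply: generated_ind => [|s|s t _ _]; [exact: rpred0| |exact: rpredD].
by rewrite mem_filter => /andP[_]; apply: mem_generated.
Qed.

Lemma point_sum2 i j i' j' :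
    (1 <= i <= n)%N -> (1 <= j <= n)%N -> (1 <= i' <= n)%N -> (1 <= j' <= n)%N ->
  (i + j = i' + j')%N -> point i + point j = point i' + point j'.
Proof.
move=> hi hj hi' hj' ij; rewrite !curve_pointE // !pair_addn.
rewrite -!mulnDl addnACA [in RHS]addnACA -!mulnDl.
by congr (_ + _ * _, _ * _)%N; lia.
Qed.

(** Two copies of [a_r] can be traded for its neighbours, so at most one copy remains. *)
Lemma curve_semigroup_cases s :
  s \in S -> s \in P \/ exists2 p, p \in P & s = point r + p.
Proof.
have rr : point r + point r \in P.
  rewrite (@point_sum2 r r r.-1 r.+1); try by lia.
  by apply: rpredD; apply: mem_punctured; lia.
move: s; apply: generated_ind.
- by left; apply: rpred0.
- move=> s /curve_generatorsP[i i1 ->]; have [->|ir] := eqVneq i r.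
    by right; exists 0; rewrite ?addr0 ?rpred0.
  by left; apply: mem_punctured.
move=> s t _ _ [sP|[p pP ->]] [tP|[q qP ->]].
- by left; apply: rpredD.
- by right; exists (s + q); rewrite ?rpredD // addrCA.
- by right; exists (p + t); rewrite ?rpredD // addrA.
by left; rewrite addrACA; apply: rpredD => //; apply: rpredD.
Qed.

Lemma absorbs_curve_semigroup a : a \in P -> point r + a \in P ->
  forall s, s \in S -> a + s \in P.
Proof.
move=> aP raP s /curve_semigroup_cases[sP|[p pP ->]]; first exact: rpredD.
by rewrite addrA (addrC a) rpredD.
Qed.

Lemma point_n : point n = (D, 0%N).
Proof. by rewrite curve_pointE ?subnn ?mul0n //; lia. Qed.

Lemma axis0_punctured : (D, 0%N) \in P.
Proof. by rewrite -point_n; apply: mem_punctured; lia. Qed.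

Lemma axis1_punctured : (0%N, D) \in P.
Proof. by rewrite -curve_point_last; apply: mem_punctured; lia. Qed.

Lemma axis0_absorbs s : s \in S -> (D, 0%N) *+ d + s \in P.
Proof.
apply: absorbs_curve_semigroup; first by apply: rpredMn; apply: axis0_punctured.
(* One copy of [(D, 0)] absorbs [a_r]; the multiple [d] is the one shared with the other axis. *)
have -> : (D, 0%N) *+ d = (D, 0%N) + (D, 0%N) *+ d.-1 by rewrite -mulrS prednK.
rewrite addrA; apply: rpredD; last first.
  by apply: rpredMn; apply: axis0_punctured.
rewrite -point_n (@point_sum2 r n r.+1 n.-1); try by lia.
by apply: rpredD; apply: mem_punctured; lia.
Qed.

Hypothesis m1_lt_r : (m1 < r)%N.

Lemma axis1_absorbs s : s \in S -> (0%N, D) *+ d + s \in P.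
Proof.
apply: absorbs_curve_semigroup; first by apply: rpredMn; apply: axis1_punctured.
have -> : point r + (0%N, D) *+ d = point 1 *+ d + point (r - m1)%N.
  rewrite !curve_pointE; try by lia.
  rewrite !pair_mulrn !pair_addn arith_termE.
  (* Writing [r = m1 + e + 1] and [n = r + f] eliminates truncated subtraction, leaving polynomial
     identities. *)
  have [e rE] : exists e, r = (m1 + e.+1)%N by exists (r - m1).-1; lia.
  have [f nE] : exists f, n = (r + f)%N by exists (n - r)%N; lia.
  have -> : (r - m1 = e.+1)%N by lia.
  have -> : (n - e.+1 = m1 + f)%N by lia.
  have -> : (n - r = f)%N by lia.
  have -> : (n - 1 = m1 + e + f)%N by lia.
  have -> : (n.-1 = m1 + e + f)%N by lia.
  have -> : (r.-1 = m1 + e)%N by lia.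
  by congr pair; rewrite /=; ring.
by apply: rpredD; [apply: rpredMn|]; apply: mem_punctured; lia.
Qed.

End Puncture.
End ArithmeticSequence.

Theorem corollary6 (K : fieldType) (n m1 d : nat)
    (K_infinite : forall s : seq K, exists x : K, x \notin s)
    (n_ge4 : (4 <= n)%N) (m1_gt0 : (0 < m1)%N) (d_gt0 : (0 < d)%N)
    (m1_d_coprime : coprime m1 d) :
  forall r : nat, (2 <= r <= n - 2)%N -> (m1 < r)%N ->
    is_macaulayfication K (punctured_curve_semigroup n m1 d r)
      (curve_semigroup n m1 d).
Proof.
move=> r r_bounds m1_lt_r; have n_gt1 : (1 < n)%N := ltnW (ltnW n_ge4).
have D_gt0 := arith_term_gt0 d m1_gt0 n.
have uP := axis0_punctured n_gt1 m1_gt0 d_gt0 r_bounds.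
have vP := axis1_punctured n_gt1 m1_gt0 d_gt0 r_bounds.
have sub := @punctured_sub n m1 d r.
split=> //.
- exact: (semigroup_simplicial D_gt0 uP vP).
- exact: (semigroup_ring_dim2 K D_gt0 uP vP).
- apply: (generated_cohen_macaulay K D_gt0); [exact: sub uP | exact: sub vP |].
  exact: curve_semigroup_saturated.
apply: (@quotient_dim0 K _ _ uP vP _ d) => s sS.
  exact: axis0_absorbs.
exact: axis1_absorbs.
Qed.
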